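(* Let $M$ be a conformal bimodule over an associative conformal algebra $\mathcal{A}$. (1) The graded vector space $C^\bullet(M,\mathcal{A})=\bigoplus_{n\ge 1}C^n(M,\mathcal{A})$ (elements of $C^n(M,\mathcal{A})$ having degree $n$), together with the derived bracket $[[\cdot,\cdot]]$, is a graded Lie algebra. An element $T\in C^1(M,\mathcal{A})$ is an $\mathcal{O}$-operator on $\mathcal{A}$ with respect to $M$ if and only if $[[T,T]]=0$. (2) If $T:M\to\mathcal{A}$ is an $\mathcal{O}$-operator, then $d_T:=[[T,\cdot]]$ is a differential which makes the graded Lie algebra $(C^\bullet(M,\mathcal{A}),[[\cdot,\cdot]])$ into a differential graded Lie algebra. Moreover, for any $T'\in C^1(M,\mathcal{A})$, $T+T'$ is an $\mathcal{O}$-operator if and only if $T'$ is a Maurer-Cartan element of $(C^\bullet(M,\mathcal{A}),[[\cdot,\cdot]],d_T)$, i.e. $d_T(T')+\tfrac12[[T',T']]=0$.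
   Context: All vector spaces are over $\mathbb{C}$. For $\mathbb{C}[\partial]$-modules $U,V,W$, a $\mathbb{C}$-bilinear map $U\times V\to W[\lambda]$, $(u,v)\mapsto u_\lambda v$, is conformal sesquilinear if $(\partial u)_\lambda v=-\lambda\, u_\lambda v$ and $u_\lambda(\partial v)=(\partial+\lambda)(u_\lambda v)$. Maps are extended coefficientwise to polynomials. An associative conformal algebra is a $\mathbb{C}[\partial]$-module $\mathcal{A}$ with a conformal sesquilinear map $(a,b)\mapsto a_\lambda b\in\mathcal{A}[\lambda]$ with $(a_\lambda b)_{\lambda+\mu}c=a_\lambda(b_\mu c)$. A conformal $\mathcal{A}$-bimodule is a $\mathbb{C}[\partial]$-module $M$ with conformal sesquilinear maps $(a,m)\mapsto a_\lambda m\in M[\lambda]$ and $(m,a)\mapsto m_\lambda a\in M[\lambda]$ such that $(a_\lambda b)_{\lambda+\mu}m=a_\lambda(b_\mu m)$, $(m_\lambda a)_{\lambda+\mu}b=m_\lambda(a_\mu b)$, $(a_\lambda m)_{\lambda+\mu}b=a_\lambda(m_\mu b)$. An $\mathcal{O}$-operator on $\mathcal{A}$ with respect to $M$ is a $\mathbb{C}[\partial]$-module homomorphism $T:M\to\mathcal{A}$ with $T(m)_\lambda T(n)=T(T(m)_\lambda n+m_\lambda T(n))$ for all $m,n\in M$. For $\mathbb{C}[\partial]$-modules $U,V$ and $n\ge1$, $C^n(U,V)$ is the space of multilinear maps $f_{\lambda_1,\dots,\lambda_{n-1}}:U^{\otimes n}\to V[\lambda_1,\dots,\lambda_{n-1}]$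 with $f_{\lambda_1,\dots,\lambda_{n-1}}(u_1,\dots,\partial u_i,\dots,u_n)=-\lambda_i f_{\lambda_1,\dots,\lambda_{n-1}}(u_1,\dots,u_n)$ for $1\le i\le n-1$ and $f_{\lambda_1,\dots,\lambda_{n-1}}(u_1,\dots,\partial u_n)=(\partial+\lambda_1+\cdots+\lambda_{n-1})f_{\lambda_1,\dots,\lambda_{n-1}}(u_1,\dots,u_n)$. In particular $C^1(U,V)$ is the space of $\mathbb{C}[\partial]$-linear maps $U\to V$. Gerstenhaber bracket. For a $\mathbb{C}[\partial]$-module $E$, $f\in C^m(E,E)$, $g\in C^n(E,E)$, put $[f,g]=f\circ g-(-1)^{(m-1)(n-1)}g\circ f\in C^{m+n-1}(E,E)$, where $$(f\circ g)_{\lambda_1,\dots,\lambda_{m+n-2}}(a_1,\dots,a_{m+n-1})=\sum_{i=1}^m(-1)^{(i-1)(n-1)}f_{\lambda_1,\dots,\lambda_{i-1},\lambda_i+\cdots+\lambda_{i+n-1},\lambda_{i+n},\dots,\lambda_{m+n-2}}\big(a_1,\dots,a_{i-1},g_{\lambda_i,\dots,\lambda_{i+n-2}}(a_i,\dots,a_{i+n-1}),a_{i+n},\dots,a_{m+n-1}\big),$$ where for $i=m$ the subscript of $f$ is just $\lambda_1,\dots,\lambda_{m-1}$. Derived bracket. Let $E=\mathcal{A}\oplus M$ and let $\hat\theta\in C^2(E,E)$ be $\hat\theta_\lambda((a,m),(b,n))=(a_\lambda b,\;a_\lambda n+m_\lambda b)$. For $f\in C^m(E,E)$, $g\in C^n(E,E)$,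 put $[[f,g]]:=(-1)^m[[\hat\theta,f],g]$, where the brackets on the right-hand side are nested Gerstenhaber brackets. For $f\in C^k(M,\mathcal{A})$ its lift $\hat f\in C^k(E,E)$ is $\hat f_{\lambda_1,\dots,\lambda_{k-1}}((a_1,u_1),\dots,(a_k,u_k))=(f_{\lambda_1,\dots,\lambda_{k-1}}(u_1,\dots,u_k),0)$. The space $C^\bullet(M,\mathcal{A})$ is identified with its image under $f\mapsto\hat f$; this image is closed under the derived bracket, and for $f\in C^m(M,\mathcal{A})$, $g\in C^n(M,\mathcal{A})$, $[[f,g]]\in C^{m+n}(M,\mathcal{A})$ denotes the element whose lift is $[[\hat f,\hat g]]$. Graded Lie algebra: a bilinear degree-$0$ bracket with $[a,b]=-(-1)^{\deg a\deg b}[b,a]$ and $[a,[b,c]]=[[a,b],c]+(-1)^{\deg a\deg b}[b,[a,c]]$ (nested brackets). Differential graded Lie algebra: in addition a linear map $d$ of degree $+1$ with $d^2=0$ and $d[a,b]=[da,b]+(-1)^{\deg a}[a,db]$. *)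

(* Defs.v *)
From HB Require Import structures.
From mathcomp Require Import all_boot all_order all_algebra finmap.
From mathcomp Require Import monalg.
From mathcomp Require Import boolp functions reals complex.

Set Implicit Arguments.
Unset Strict Implicit.
Unset Printing Implicit Defensive.

Import GRing.Theory.
Local Open Scope fset_scope.
Local Open Scope ring_scope.

(* Over a field K, a K[∂]-module is an lmodType over {poly K}: ∂ acts as 'X and
   c in K as c%:P.  All indices of variables and arguments start at 0, so that
   λ_1, λ_2, ... and u_1, u_2, ... are written λ_0, λ_1, ... and u_0, u_1, ... *)

(* The ring K[∂][λ_0, λ_1, ...]. *)
Notation lring K := {malg {poly K}[{cmonom nat}]}.

(* Monomials are locked because comparing two distinct << _ *g _ >> by
   conversion does not terminate in practice. *)
HB.lock Definition rmono {K : fieldType} (c : {poly K}) (a : {cmonom nat}) :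
  lring K := << c *g a >>.
Canonical rmono_unlock := Unlockable rmono.unlock.

Definition lam {K : fieldType} (i : nat) : lring K := rmono 1 (ucm i).
Definition dd {K : fieldType} : lring K := rmono 'X mone.
Definition scal {K : fieldType} (c : K) : lring K := rmono c%:P mone.

(* V[λ_0, λ_1, ...], of which V[λ_0, ..., λ_(k-1)] is the submodule of the
   polynomials satisfying [in_vars k].  It is a module over K[∂][λ_0, λ_1, ...]
   (∂ acting on coefficients). *)
Definition lpoly {K : fieldType} (V : lmodType {poly K}) : Type :=
  {malg V[{cmonom nat}]}.

HB.instance Definition _ (K : fieldType) (V : lmodType {poly K}) :=
  GRing.Zmodule.copy (lpoly V) {malg V[{cmonom nat}]}.

HB.lock Definition lmono {K : fieldType} {V : lmodType {poly K}} (v : V)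
  (a : {cmonom nat}) : lpoly V := << v *g a >>.
Canonical lmono_unlock := Unlockable lmono.unlock.

HB.lock Definition lscale {K : fieldType} {V : lmodType {poly K}}
    (p : lring K) (P : lpoly V) : lpoly V :=
  \sum_(a <- msupp p) \sum_(b <- msupp P) lmono (p@_a *: P@_b) (mmul a b).
Canonical lscale_unlock := Unlockable lscale.unlock.

Section LPolyModule.
Variables (K : fieldType) (V : lmodType {poly K}).
Implicit Types (P Q : lpoly V) (p q : lring K).
Local Notation lscale := (@lscale K V).

Lemma lmonoD a : {morph (@lmono K V)^~ a : v w / v + w}.
Proof. by move=> v w; rewrite unlock monalgUD. Qed.

Local Lemma lmono0 a : lmono (0 : V) a = 0.
Proof. by rewrite unlock monalgU0. Qed.

Local Lemma rmonoM c d a b :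
  @rmono K c a * rmono d b = rmono (c * d) (mmul a b).
Proof. by rewrite unlock malgM_def fgmulUU. Qed.

Local Lemma lscalew (d1 d2 : {fset {cmonom nat}}) p P :
  msupp p `<=` d1 -> msupp P `<=` d2 ->
  lscale p P = \sum_(a <- d1) \sum_(b <- d2) lmono (p@_a *: P@_b) (mmul a b).
Proof.
move=> le_d1 le_d2; rewrite unlock (big_fset_incl _ le_d1) /=.
  apply/eq_bigr=> k1 _; apply/big_fset_incl => // k _ /mcoeff_outdom ->.
  by rewrite scaler0 lmono0.
move=> k _ /mcoeff_outdom g1k.
by rewrite big1 => // k' _; rewrite g1k scale0r lmono0.
Qed.

Local Lemma lscaleDl P : {morph lscale^~ P : p q / p + q}.
Proof.
move=> p q.
rewrite (lscalew (msuppD_le p q) (fsubset_refl (msupp P))).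
rewrite (lscalew (fsubsetUl _ (msupp q)) (fsubset_refl (msupp P))).
rewrite (lscalew (fsubsetUr (msupp p) _) (fsubset_refl (msupp P))).
rewrite -big_split /=; apply/eq_bigr=> a _.
rewrite -big_split /=; apply/eq_bigr=> b _.
by rewrite mcoeffD scalerDl lmonoD.
Qed.

Local Lemma lscaleDr : right_distributive lscale +%R.
Proof.
move=> p P Q.
rewrite (lscalew (fsubset_refl (msupp p)) (msuppD_le P Q)).
rewrite (lscalew (fsubset_refl (msupp p)) (fsubsetUl _ (msupp Q))).
rewrite (lscalew (fsubset_refl (msupp p)) (fsubsetUr (msupp P) _)).
rewrite -big_split /=; apply/eq_bigr=> a _.
rewrite -big_split /=; apply/eq_bigr=> b _.
by rewrite mcoeffD scalerDr lmonoD.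
Qed.

Local Lemma lscale0 p : lscale p 0 = 0.
Proof. by apply: (addrI (lscale p 0)); rewrite -lscaleDr !addr0. Qed.

Local Lemma l0scale P : lscale 0 P = 0.
Proof. by apply: (addrI (lscale 0 P)); rewrite -lscaleDl !addr0. Qed.

Local Lemma lscaleUU c v a b :
  lscale (rmono c a) (lmono v b) = lmono (c *: v) (mmul a b).
Proof.
rewrite rmono.unlock lmono.unlock.
by rewrite (lscalew msuppU_le msuppU_le) !big_seq_fset1 !mcoeffUU
  lmono.unlock.
Qed.

Local Lemma lring_ext (X : zmodType) (f g : lring K -> X) :
  {morph f : p q / p + q} -> {morph g : p q / p + q} ->
  (forall c a, f (rmono c a) = g (rmono c a)) -> f =1 g.
Proof.
move=> fD gD; rewrite unlock => fg p; rewrite [p]monalgE.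
have f0 : f 0 = 0 by apply: (addrI (f 0)); rewrite -fD !addr0.
have g0 : g 0 = 0 by apply: (addrI (g 0)); rewrite -gD !addr0.
by rewrite (big_morph f fD f0) (big_morph g gD g0); apply: eq_bigr.
Qed.

Local Lemma lpoly_ext (X : zmodType) (f g : lpoly V -> X) :
  {morph f : P Q / P + Q} -> {morph g : P Q / P + Q} ->
  (forall v a, f (lmono v a) = g (lmono v a)) -> f =1 g.
Proof.
move=> fD gD; rewrite unlock => fg P; rewrite [P](@monalgE _ V).
have f0 : f 0 = 0 by apply: (addrI (f 0)); rewrite -fD !addr0.
have g0 : g 0 = 0 by apply: (addrI (g 0)); rewrite -gD !addr0.
by rewrite (big_morph f fD f0) (big_morph g gD g0); apply: eq_bigr.
Qed.

Local Lemma lscaleA p q P : lscale p (lscale q P) = lscale (p * q) P.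
Proof.
apply: (lpoly_ext (f := fun P => lscale p (lscale q P))) => [x y|x y|v e].
- by rewrite !lscaleDr.
- by rewrite lscaleDr.
apply: (lring_ext (f := fun q => lscale p (lscale q _))
  (g := fun q => lscale (p * q) _)) => [x y|x y|d b].
- by rewrite lscaleDl lscaleDr.
- by rewrite mulrDr lscaleDl.
apply: (lring_ext (f := lscale^~ _) (g := fun p => lscale (p * _) _))
  => [x y|x y|c a].
- by rewrite lscaleDl.
- by rewrite mulrDl lscaleDl.
by rewrite rmonoM !lscaleUU scalerA mulmA.
Qed.

Local Lemma l1scale : left_id 1 lscale.
Proof.
have -> : 1 = rmono 1 mone :> lring K by rewrite unlock.
apply: lpoly_ext => [x y|//|v a]; first exact: lscaleDr.
by rewrite lscaleUU scale1r mul1m.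
Qed.

HB.instance Definition _ := GRing.Zmodule_isLmodule.Build (lring K) (lpoly V)
  lscaleA l1scale lscaleDr lscaleDl.

Lemma scale_mono c (v : V) a b :
  rmono c a *: lmono v b = lmono (c *: v) (mmul a b) :> lpoly V.
Proof. exact: lscaleUU. Qed.

End LPolyModule.

Section LPolyOps.
Variables (K : fieldType).
Implicit Types (V W : lmodType {poly K}).

Definition in_vars V (k : nat) (P : lpoly V) : Prop :=
  forall m : {cmonom nat}, m \in msupp P -> forall i, (k <= i)%N -> m i = 0%N.

Definition cst V (v : V) : lpoly V := lmono v mone.

(* Coefficientwise extension: sum_m λ^m v_m |-> sum_m λ^m h(v_m). *)
Definition ext V W (h : V -> lpoly W) (P : lpoly V) : lpoly W :=
  \sum_(m <- msupp P) rmono 1 m *: h P@_m.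

Definition lmap V W (h : V -> W) (P : lpoly V) : lpoly W :=
  ext (fun v => cst (h v)) P.

(* Substitution λ_i := s i in the variables of P. *)
Definition lsubst V (s : nat -> lring K) (P : lpoly V) : lpoly V :=
  \sum_(m <- msupp P) (\prod_(i <- finsupp m) s i ^+ m i) *: cst P@_m.

End LPolyOps.

Section Conformal.
Variable (K : fieldType).
Implicit Types (U V W : lmodType {poly K}).

(* A λ-product (u, v) |-> u_λ v is given by its values in W[λ_0];
   [at_ op s u v] is u_s v. *)
Definition at_ U V W (op : U -> V -> lpoly W) (s : lring K) (u : U) (v : V) :
  lpoly W := lsubst (fun=> s) (op u v).

Record sesquilinear U V W (op : U -> V -> lpoly W) : Prop := {
  sesq_vars : forall u v, in_vars 1 (op u v);
  sesq_linl : forall (c : K) u u' v,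
    op (c%:P *: u + u') v = scal c *: op u v + op u' v;
  sesq_linr : forall (c : K) u v v',
    op u (c%:P *: v + v') = scal c *: op u v + op u v';
  sesq_ddl : forall u v, op ('X *: u) v = - lam 0 *: op u v;
  sesq_ddr : forall u v, op u ('X *: v) = (dd + lam 0) *: op u v }.

(* (u_λ v)_(λ+μ) w = u_λ (v_μ w), with λ = λ_0 and μ = λ_1; op1 and op2 are the
   products on the left-hand side, op3 and op4 those on the right-hand side. *)
Definition conf_assoc U V W X Y Z
    (op1 : U -> V -> lpoly X) (op2 : X -> W -> lpoly Z)
    (op3 : V -> W -> lpoly Y) (op4 : U -> Y -> lpoly Z) : Prop :=
  forall u v w,
    ext (fun x => at_ op2 (lam 0 + lam 1) x w) (at_ op1 (lam 0) u v) =
    ext (fun y => at_ op4 (lam 0) u y) (at_ op3 (lam 1) v w).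

Record assoc_conformal_algebra (A : lmodType {poly K})
    (mu : A -> A -> lpoly A) : Prop := {
  aca_sesq : sesquilinear mu;
  aca_assoc : conf_assoc mu mu mu mu }.

Record conformal_bimodule (A M : lmodType {poly K}) (mu : A -> A -> lpoly A)
    (l : A -> M -> lpoly M) (r : M -> A -> lpoly M) : Prop := {
  cbm_sesql : sesquilinear l;
  cbm_sesqr : sesquilinear r;
  cbm_assocl : conf_assoc mu l l l;
  cbm_assocr : conf_assoc r r mu r;
  cbm_assoclr : conf_assoc l r r l }.

Definition O_operator (A M : lmodType {poly K}) (mu : A -> A -> lpoly A)
    (l : A -> M -> lpoly M) (r : M -> A -> lpoly M) (T : {linear M -> A}) :
    Prop :=
  forall m n, mu (T m) (T n) = lmap T (l (T m) n + r m (T n)).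

End Conformal.

(* A cochain of U^n -> V[λ_0, ..., λ_(n-2)] is represented as a map on sequences
   u : nat -> U which depends on u_0, ..., u_(n-1) only; this turns all C^n(U,V)
   into subspaces of a single K-vector space. *)
Definition cochains {K : fieldType} (U V : lmodType {poly K}) : Type :=
  (nat -> U) -> lpoly V.

Section CochainSpace.
Variables (K : fieldType) (U V : lmodType {poly K}).

HB.instance Definition _ :=
  GRing.Zmodule.copy (cochains U V) ((nat -> U) -> lpoly V).

Local Lemma scalM (a b : K) : scal a * scal b = scal (a * b).
Proof. by rewrite /scal unlock malgM_def fgmulUU mulm1 polyCM. Qed.
Local Lemma scalD (a b : K) : scal (a + b) = scal a + scal b.
Proof. by rewrite /scal unlock polyCD monalgUD. Qed.
Local Lemma scal1 : scal 1 = 1 :> lring K.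
Proof. by rewrite /scal unlock. Qed.

Definition cscale (c : K) (f : cochains U V) : cochains U V :=
  fun u => scal c *: f u.

Local Lemma cscaleA a b f : cscale a (cscale b f) = cscale (a * b) f.
Proof. by apply/funext => u; rewrite /cscale scalerA scalM. Qed.
Local Lemma c1scale : left_id 1 cscale.
Proof. by move=> f; apply/funext => u; rewrite /cscale scal1 scale1r. Qed.
Local Lemma cscaleDr : right_distributive cscale +%R.
Proof. by move=> c f g; apply/funext => u; rewrite /cscale scalerDr. Qed.
Local Lemma cscaleDl f : {morph cscale^~ f : a b / a + b}.
Proof.
move=> a b; apply/funext => u.
by rewrite /cscale scalD scalerDl.
Qed.

HB.instance Definition _ := GRing.Zmodule_isLmodule.Build K (cochains U V)
  cscaleA c1scale cscaleDr cscaleDl.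

End CochainSpace.

Section Cochains.
Variable (K : fieldType).
Implicit Types (U V E : lmodType {poly K}).

Definition upd U (u : nat -> U) (i : nat) (x : U) : nat -> U :=
  fun j => if j == i then x else u j.

(* C^n(U,V), for n >= 1. *)
Record is_cochain U V (n : nat) (f : cochains U V) : Prop := {
  coch_arity : forall u v, (forall j, (j < n)%N -> u j = v j) -> f u = f v;
  coch_vars : forall u, in_vars n.-1 (f u);
  coch_lin : forall u i (c : K) x y, (i < n)%N ->
    f (upd u i (c%:P *: x + y)) = scal c *: f (upd u i x) + f (upd u i y);
  coch_dd : forall u i, (i < n.-1)%N ->
    f (upd u i ('X *: u i)) = - lam i *: f u;
  coch_ddlast : forall u,
    f (upd u n.-1 ('X *: u n.-1)) = (dd + \sum_(j < n.-1) lam j) *: f u }.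

(* The homogeneous components of the direct sum of the C^n(U,V), n >= 1. *)
Definition cochain_piece U V (n : nat) (f : cochains U V) : Prop :=
  if n is 0%N then f = 0 else is_cochain n f.

(* A K[∂]-linear map as an element of C^1(U,V). *)
Definition hom1 U V (T : {linear U -> V}) : cochains U V :=
  fun u => cst (T (u 0%N)).

(* (u_0, ..., u_(i-1), x, u_(i+n), u_(i+n+1), ...) *)
Definition insert U (i n : nat) (x : U) (u : nat -> U) : nat -> U :=
  fun j => if (j < i)%N then u j else if j == i then x else u (j + n).-1.

(* (λ_0, ..., λ_(i-1), λ_i + ... + λ_(i+n-1), λ_(i+n), λ_(i+n+1), ...).
   In the last term of f ∘ g (i = m-1) the entry of index i is not used, since f
   only involves the variables of index < m-1. *)
Definition merge_vars (i n : nat) : nat -> lring K :=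
  fun j => if (j < i)%N then lam j
           else if j == i then \sum_(i <= k < i + n) lam k else lam (j + n).-1.

Definition circ E (m n : nat) (f g : cochains E E) : cochains E E := fun u =>
  \sum_(i < m) (-1) ^+ (i * n.-1) *:
    ext (fun x => lsubst (merge_vars i n) (f (insert i n x u)))
        (lsubst (fun j => lam (i + j)) (g (fun j => u (i + j)%N))).

Definition gerst E (m n : nat) (f g : cochains E E) : cochains E E :=
  circ m n f g - (-1) ^+ (m.-1 * n.-1) *: circ n m g f.

End Cochains.

Section OneCochains.
Variables (K : fieldType) (U V : lmodType {poly K}).

Local Lemma in_vars0 (P : lpoly V) : in_vars 0 P -> P = cst (P@_mone).
Proof.
move=> P0; apply/malgP => m; rewrite /cst lmono.unlock mcoeffU.
case: eqVneq => [<-//|m1]; rewrite mulr0n; apply: mcoeff_outdom.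
apply: contraNN m1 => /P0 m0; rewrite eq_sym; apply/eqP/eqP/cmP => i.
by rewrite m0 // cm1.
Qed.

Local Lemma cstK (v : V) : (cst v)@_mone = v.
Proof. by rewrite /cst lmono.unlock mcoeffUU. Qed.
Local Lemma cstD (v w : V) : cst (v + w) = cst v + cst w.
Proof. exact: lmonoD. Qed.

Lemma cochain1P (f : cochains U V) :
  is_cochain 1 f <-> exists T : {linear U -> V}, f = hom1 T.
Proof.
split=> [[ar vars lin _ ddl]|[T ->]]; last first.
  split=> //= [u v uv|u m|u i c x y|u].
  - by rewrite /hom1 uv.
  - rewrite /hom1 /cst lmono.unlock => /(fsubsetP msuppU_le).
    by rewrite in_fset1 => /eqP -> i _; rewrite cm1.
  - rewrite ltnS leqn0 => /eqP ->; rewrite /hom1 /upd eqxx linearP cstD.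
    by rewrite /cst scale_mono mulm1.
  - by rewrite big_ord0 addr0 /hom1 /upd eqxx linearZ /cst scale_mono mulm1.
pose T x := (f (fun=> x))@_mone.
have fE u : f u = cst (T (u 0%N)).
  rewrite (ar u (fun=> u 0%N)); last by case.
  exact: in_vars0 (vars _).
have up0 x y : f (upd (fun=> x) 0 y) = cst (T y) by rewrite fE /upd eqxx.
have cstI : injective (@cst K V).
  by move=> v w /(congr1 (mcoeff mone)); rewrite !cstK.
have Tlin (c : K) x y : T (c%:P *: x + y) = c%:P *: T x + T y.
  apply: cstI; rewrite -(up0 0) lin // !up0 cstD.
  by rewrite /cst scale_mono mulm1.
have TX x : T ('X *: x) = 'X *: T x.
  apply: cstI; rewrite -(up0 x) (ddl (fun=> x)) big_ord0 addr0 fE.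
  by rewrite /cst scale_mono mulm1.
have TD x y : T (x + y) = T x + T y.
  by rewrite -[x]scale1r Tlin !scale1r.
have T0 : T 0 = 0 by apply: (addrI (T 0)); rewrite -TD !addr0.
have TZ p x : T (p *: x) = p *: T x.
  elim/poly_ind: p x => [|p c IH] x; first by rewrite !scale0r T0.
  rewrite addrC !scalerDl Tlin -!scalerA IH TX.
  by rewrite scalerA.
have Tl : linear T by move=> p x y; rewrite TD TZ.
pose mT := GRing.isLinear.Build _ _ _ _ T Tl.
pose T' : {linear U -> V} := HB.pack T mT.
by exists T'; apply/funext => u; rewrite fE.
Qed.
End OneCochains.

Section DerivedBracket.
Variables (K : fieldType) (A M : lmodType {poly K}).
Variables (mu : A -> A -> lpoly A) (l : A -> M -> lpoly M)
  (r : M -> A -> lpoly M).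

Let E : lmodType {poly K} := (A * M)%type.

Definition theta_hat : cochains E E := fun e =>
  let: (a, m) := e 0%N in let: (b, n) := e 1%N in
  lmap (fun x => (x, 0)) (mu a b) + lmap (fun y => (0, y)) (l a n + r m b).

Definition derived (m n : nat) (f g : cochains E E) : cochains E E :=
  (-1) ^+ m *: gerst m.+1 n (gerst 2 m theta_hat f) g.

Definition lift_hat (f : cochains M A) : cochains E E := fun e =>
  lmap (fun x => (x, 0)) (f (fun i => (e i).2)).

(* The cochain whose lift is [derived m n (lift_hat f) (lift_hat g)], recovered
   by restricting the latter to M and projecting it to A. *)
Definition dbracket (m n : nat) (f g : cochains M A) : cochains M A := fun u =>
  lmap fst (derived m n (lift_hat f) (lift_hat g) (fun i => (0, u i))).

End DerivedBracket.

(* A graded vector space is given by subspaces L n (n : nat) of a vector space X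
   (its homogeneous components, L n being in degree n); [br m n] is the bracket
   L m x L n -> L (m + n), whose values outside of L m x L n are irrelevant. *)
Record graded_lie (K : fieldType) (X : lmodType K) (L : nat -> X -> Prop)
    (br : nat -> nat -> X -> X -> X) : Prop := {
  gl_zero : forall n, L n 0;
  gl_subspace : forall n (c : K) a b, L n a -> L n b -> L n (c *: a + b);
  gl_deg : forall m n a b, L m a -> L n b -> L (m + n)%N (br m n a b);
  gl_linl : forall m n (c : K) a a' b, L m a -> L m a' -> L n b ->
    br m n (c *: a + a') b = c *: br m n a b + br m n a' b;
  gl_linr : forall m n (c : K) a b b', L m a -> L n b -> L n b' ->
    br m n a (c *: b + b') = c *: br m n a b + br m n a b';
  gl_antisym : forall m n a b, L m a -> L n b ->
    br m n a b = - ((-1) ^+ (m * n) *: br n m b a);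
  gl_jacobi : forall m n p a b c, L m a -> L n b -> L p c ->
    br m (n + p)%N a (br n p b c) =
      br (m + n)%N p (br m n a b) c +
      (-1) ^+ (m * n) *: br n (m + p)%N b (br m p a c) }.

(* [d n] is the differential L n -> L n.+1. *)
Record dg_lie (K : fieldType) (X : lmodType K) (L : nat -> X -> Prop)
    (br : nat -> nat -> X -> X -> X) (d : nat -> X -> X) : Prop := {
  dgl_lie : graded_lie L br;
  dgl_deg : forall n a, L n a -> L n.+1 (d n a);
  dgl_lin : forall n (c : K) a b, L n a -> L n b ->
    d n (c *: a + b) = c *: d n a + d n b;
  dgl_dd : forall n a, L n a -> d n.+1 (d n a) = 0;
  dgl_leibniz : forall m n a b, L m a -> L n b ->
    d (m + n)%N (br m n a b) =
      br m.+1 n (d m a) b + (-1) ^+ m *: br m n.+1 a (d n b) }.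

(* Main.v *)
Require Import Defs.
From HB Require Import structures.
From mathcomp Require Import all_boot all_order all_algebra finmap.
From mathcomp Require Import monalg.
From mathcomp Require Import boolp reals complex zify.
Set Implicit Arguments.
Unset Strict Implicit.
Unset Printing Implicit Defensive.
Import GRing.Theory.
Local Open Scope fset_scope.
Local Open Scope ring_scope.

(** The Gerstenhaber bracket is a signed sum of insertions [f ∘_i g].  Insertion
    satisfies the two associativity laws of an operad (nested and disjoint
    insertions), whence the graded pre-Lie identity for [f ∘ g] and the graded
    Jacobi identity for its commutator.

    [theta_hat] is the product of the semidirect sum of [A] and [M], so that its
    associativity is [theta ∘ theta = 0] and [D = [theta, -]] squares to zero.
    The lifts of the cochains in [C^n(M, A)] commute with each other, and for
    such a family [(-1)^m [D f, g]] is a graded Lie bracket, by three uses of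
    the Jacobi identity.

    To see that this bracket produces lifts again, let a scalar [c] act on
    [A + M] by [(a, m) |-> (a, c m)], and say that [F] has weight [w] if
    [F (c u) = c^w c (F u)].  Then [theta] has weight 0, the lift of an
    [n]-cochain has weight [n], and weights add up under insertion.  Conversely
    an [n]-cochain of weight [n] is a lift: on arguments of which [b] lie in [M]
    and [n - b] in [A], multilinearity makes it scale by [c^b], whereas its
    components in [A] and [M] scale by [c^n] and [c^(n+1)].

    Finally [[T, T]] is [-2] times the defect of the [O]-operator equation. *)

(** * Polynomials in the λ_i and substitutions *)
Lemma morph_add0 (V W : zmodType) (f : V -> W) :
  {morph f : x y / x + y} -> f 0 = 0.
Proof. by move=> fD; apply: (addrI (f 0)); rewrite -fD !addr0. Qed.

Lemma morph_addN (V W : zmodType) (f : V -> W) :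
  {morph f : x y / x + y} -> {morph f : x / - x}.
Proof.
by move=> fD x; apply: (addrI (f x)); rewrite -fD !subrr (morph_add0 fD).
Qed.

Lemma morph_add_sum (V W : zmodType) (f : V -> W) I (r : seq I) P (F : I -> V) :
  {morph f : x y / x + y} ->
  f (\sum_(i <- r | P i) F i) = \sum_(i <- r | P i) f (F i).
Proof. by move=> fD; apply: big_morph => //; apply: morph_add0. Qed.

Section MalgSum.
Variables (C : choiceType) (G X : zmodType) (F : G -> C -> X).
Hypothesis FD : forall m, {morph F^~ m : x y / x + y}.

Let F0 m : F 0 m = 0 := morph_add0 (FD m).

Let malg_sumw (d : {fset C}) (g : {malg G[C]}) : msupp g `<=` d ->
  \sum_(m <- msupp g) F g@_m m = \sum_(m <- d) F g@_m m.
Proof. by move=> le_d; apply: big_fset_incl => // k _ /mcoeff_outdom ->; apply: F0. Qed.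

(** As [F 0 m = 0], the sum may run over any finite set containing the support. The supports of [g],
    [h] and [g + h] all lie in the union of the first two, where the sums are compared termwise. *)
Lemma malg_sumD :
  {morph (fun g : {malg G[C]} => \sum_(m <- msupp g) F g@_m m) : g h / g + h}.
Proof.
move=> g h /=; rewrite (malg_sumw (msuppD_le g h)).
rewrite (malg_sumw (fsubsetUl _ (msupp h))) (malg_sumw (fsubsetUr (msupp g) _)).
by rewrite -big_split; apply: eq_bigr => m _; rewrite mcoeffD FD.
Qed.

Lemma malg_sumU v a :
  \sum_(m <- msupp << v *g a >>) F << v *g a >>@_m m = F v a.
Proof. by rewrite (malg_sumw msuppU_le) big_seq_fset1 mcoeffUU. Qed.

End MalgSum.

(** The value of the monomial [a] at λ_i := [s i]; [rsubst] and [lsubst] are its linear extensions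
    to scalars and to polynomials with coefficients in a module. *)
Definition mev {K : fieldType} (s : nat -> lring K) (a : {cmonom nat}) :
  lring K := \prod_(i <- finsupp a) s i ^+ a i.

(* Locked, like [lsub] below, because unification of two distinct products in
   [lring K] does not terminate in practice. *)
HB.lock Definition rsubst {K : fieldType} (s : nat -> lring K) (p : lring K) :
  lring K := \sum_(m <- msupp p) rmono p@_m mone * mev s m.
Canonical rsubst_unlock := Unlockable rsubst.unlock.

Section Calculus.
Variable K : fieldType.
Implicit Types (V W : lmodType {poly K}) (s t : nat -> lring K).
Implicit Types (a b : {cmonom nat}) (p q : lring K).

Lemma mevw s a (d : {fset nat}) : finsupp a `<=` d ->
  mev s a = \prod_(i <- d) s i ^+ a i.
Proof.
by move=> ad; apply: big_fset_incl => // i _; rewrite -cmE_eq0 => /eqP ->.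
Qed.

Lemma mev1 s : mev s mone = 1.
Proof. by rewrite /mev mdom1 big_seq_fset0. Qed.

Lemma mevM s a b : mev s (mmul a b) = mev s a * mev s b.
Proof.
rewrite (@mevw s a _ (fsubsetUl _ (finsupp b))).
rewrite (@mevw s b _ (fsubsetUr (finsupp a) _)).
rewrite /mev mdomD -big_split; apply: eq_bigr => i _.
by rewrite cmM exprD.
Qed.

Lemma mevU s i : mev s (ucm i) = s i.
Proof. by rewrite /mev mdomU big_seq_fset1 cmUU expr1. Qed.

Lemma rmono1 : rmono 1 mone = 1 :> lring K.
Proof. by rewrite unlock. Qed.

Lemma rmonoD a : {morph (@rmono K)^~ a : c d / c + d}.
Proof. by move=> c d; rewrite unlock monalgUD. Qed.

Lemma lmonoE V (v : V) a : lmono v a = rmono 1 a *: cst v.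
Proof. by rewrite /cst scale_mono scale1r mulm1. Qed.

Lemma cst_is_additive V : {morph @cst K V : v w / v + w}.
Proof. exact: lmonoD. Qed.

Lemma cstZ V c (v : V) : cst (c *: v) = rmono c mone *: cst v.
Proof. by rewrite /cst scale_mono mulm1. Qed.

Lemma rsubst_mono s c a : rsubst s (rmono c a) = rmono c mone * mev s a.
Proof.
have FD m : {morph (fun c => rmono c mone * mev s m) : c d / c + d}.
  by move=> x y; rewrite rmonoD mulrDl.
rewrite rsubst.unlock (_ : rmono c a = << c *g a >>); last by rewrite rmono.unlock.
exact: (malg_sumU FD c a).
Qed.

Lemma rsubstD s : {morph rsubst s : p q / p + q}.
Proof.
rewrite rsubst.unlock.
by apply: (malg_sumD (F := fun c a => rmono c mone * mev s a)) => m x y;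
  rewrite rmonoD mulrDl.
Qed.

Lemma rsubstM s : {morph rsubst s : p q / p * q}.
Proof.
move=> p; apply: (Defs.lring_ext (f := fun q => rsubst s (p * q))
  (g := fun q => rsubst s p * rsubst s q)) => [x y|x y|d b].
- by rewrite mulrDr rsubstD.
- by rewrite rsubstD mulrDr.
apply: (Defs.lring_ext (f := fun p => rsubst s (p * _))
  (g := fun p => rsubst s p * _)) => [x y|x y|c a].
- by rewrite mulrDl rsubstD.
- by rewrite rsubstD mulrDl.
rewrite Defs.rmonoM !rsubst_mono mevM mulrACA Defs.rmonoM.
by rewrite mul1m.
Qed.

Lemma rsubst1 s : rsubst s 1 = 1.
Proof. by rewrite -rmono1 rsubst_mono mev1 mulr1. Qed.

Lemma rsubst_nmod s : nmod_morphism (rsubst s).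
Proof. by split; [apply: morph_add0 (rsubstD s) | apply: rsubstD]. Qed.

Lemma rsubst_monoid s : monoid_morphism (rsubst s).
Proof. by split; [apply: rsubst1 | apply: rsubstM]. Qed.

HB.instance Definition _ s := GRing.isNmodMorphism.Build
  (lring K) (lring K) (rsubst s) (rsubst_nmod s).
HB.instance Definition _ s := GRing.isMonoidMorphism.Build
  (lring K) (lring K) (rsubst s) (rsubst_monoid s).

Lemma rsubst_lam s i : rsubst s (lam i) = s i.
Proof. by rewrite /lam rsubst_mono mevU rmono1 mul1r. Qed.

Lemma rsubst_rmono s c : rsubst s (rmono c mone) = rmono c mone.
Proof. by rewrite rsubst_mono mev1 mulr1. Qed.

Lemma rsubst_dd s : rsubst s dd = dd.
Proof. exact: rsubst_rmono. Qed.

Lemma mev_rsubst s t a : rsubst s (mev t a) = mev (rsubst s \o t) a.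
Proof.
by rewrite /mev rmorph_prod; apply: eq_bigr => i _ /=; rewrite rmorphXn.
Qed.

Lemma lsubstD V s : {morph @lsubst K V s : P Q / P + Q}.
Proof.
apply: (malg_sumD (F := fun (v : V) a => mev s a *: cst v)) => m x y.
by rewrite cst_is_additive scalerDr.
Qed.

Lemma lsubst_mono V s (v : V) a : lsubst s (lmono v a) = mev s a *: cst v.
Proof.
have FD m : {morph (fun v : V => mev s m *: cst v) : v w / v + w}.
  by move=> x y; rewrite cst_is_additive scalerDr.
rewrite /lsubst (_ : lmono v a = << v *g a >>); last by rewrite lmono.unlock.
exact: (malg_sumU FD v a).
Qed.

Lemma lsubst_cst V s (v : V) : lsubst s (cst v) = cst v.
Proof. by rewrite lsubst_mono mev1 scale1r. Qed.

Lemma lsubstZ V s p (P : lpoly V) : lsubst s (p *: P) = rsubst s p *: lsubst s P.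
Proof.
apply: (Defs.lpoly_ext (f := fun P => lsubst s (p *: P))
  (g := fun P => rsubst s p *: lsubst s P)) => [x y|x y|v b].
- by rewrite scalerDr lsubstD.
- by rewrite lsubstD scalerDr.
apply: (Defs.lring_ext (f := fun p => lsubst s (p *: _))
  (g := fun p => rsubst s p *: _)) => [x y|x y|c a].
- by rewrite scalerDl lsubstD.
- by rewrite rsubstD scalerDl.
rewrite scale_mono !lsubst_mono rsubst_mono mevM cstZ [LHS]scalerA [RHS]scalerA.
exact: (congr1 ( *:%R^~ (cst v)) (etrans (mulrC _ _) (mulrA _ _ _))).
Qed.

Lemma lsubst_lsubst V s t (P : lpoly V) :
  lsubst s (lsubst t P) = lsubst (rsubst s \o t) P.
Proof.
apply: (Defs.lpoly_ext (f := fun P => lsubst s (lsubst t P))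
  (g := lsubst (rsubst s \o t))) => [x y|x y|v a].
- by rewrite 2!lsubstD.
- by rewrite lsubstD.
by rewrite [RHS]lsubst_mono (lsubst_mono t) lsubstZ lsubst_cst mev_rsubst.
Qed.

(** By induction on the degree: a variable of the support is split off. It makes the substitution
    λ_i := λ_i the identity. *)
Lemma mev_lam a : mev lam a = rmono 1 a :> lring K.
Proof.
have [n] := ubnP (mdeg a); elim: n a => // n IH a; rewrite ltnS => an.
have [a0|[i ia]] := fset_0Vmem (finsupp a).
  by rewrite /mev a0 big_seq_fset0 -rmono1; congr rmono;
    apply/esym/mdeg_eq0I; rewrite mdegE a0 big_seq_fset0.
have aE : a = mmul (ucm i) (divcm a (ucm i)).
  apply/eqP/cmP => j; rewrite cmM divcmE cmU subnKC //.
  by case: eqVneq => [<-|//]; rewrite lt0n cmE_neq0.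
rewrite aE mevM mevU IH; first by rewrite Defs.rmonoM mulr1.
by apply: leq_trans an; rewrite {2}aE mdegM mdegU.
Qed.

Lemma lsubst_lam V (P : lpoly V) : lsubst lam P = P.
Proof.
apply: (Defs.lpoly_ext (g := id)) => [x y|x y|v a] //; first exact: lsubstD.
by rewrite lsubst_mono mev_lam lmonoE.
Qed.

Lemma eq_mev s t a : (forall i, a i != 0%N -> s i = t i) -> mev s a = mev t a.
Proof.
move=> st; apply: eq_big_seq => i; rewrite -cmE_neq0 => /st stE.
exact: (congr1 (fun x => x ^+ a i) stE).
Qed.

Lemma eq_lsubst V k s t (P : lpoly V) : in_vars k P ->
  (forall i, (i < k)%N -> s i = t i) -> lsubst s P = lsubst t P.
Proof.
move=> Pk st; apply: eq_big_seq => m mP.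
apply: (congr1 ( *:%R^~ (cst P@_m))); apply: eq_mev => i mi; apply: st.
by rewrite ltnNge; apply: contraNN mi => /(Pk _ mP) ->.
Qed.

(** The substitution killing λ_i for i >= k. Its fixed points are V[λ_0, ..., λ_(k-1)], which turns
    [in_vars k], a condition on supports, into an equation that composes well with other
    substitutions. *)
Definition trunc k : nat -> lring K := fun i => if (i < k)%N then lam i else 0.

Lemma in_varsP V k (P : lpoly V) : in_vars k P <-> lsubst (trunc k) P = P.
Proof.
split=> [Pk|<-].
  rewrite -[RHS]lsubst_lam; apply: (eq_lsubst Pk) => i ik.
  by rewrite /trunc ik.
move=> m mP i ki; apply/eqP; apply: contraLR mP => mi.
rewrite -mcoeff_eq0 /lsubst raddf_sum; apply/eqP; apply: big1 => b _ /=.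
rewrite -[\prod_(_ <- _) _]/(mev (trunc k) b).
(* A monomial in the first k variables is fixed, hence different from [m], which contains λ_i with i
   >= k. Any other monomial contains a variable sent to 0. *)
have [bk|] := boolP [forall j : finsupp b, (val j < k)%N].
  rewrite (@eq_mev _ lam) ?mev_lam; last first.
    move=> j; rewrite cmE_neq0 => jb; rewrite /trunc.
    by rewrite (forallP bk [` jb]).
  rewrite -lmonoE lmono.unlock mcoeffU; case: eqVneq => [bm|//].
  move: bk; rewrite bm => bk; have im : i \in finsupp m by rewrite -cmE_neq0.
  by have := forallP bk [` im]; rewrite /= ltnNge ki.
rewrite negb_forall => /existsP[[j jb] /= jk].
rewrite /mev (big_fsetD1 j) //= /trunc (negPf jk).
move: jb; rewrite -cmE_neq0; case: (b j) => // n _.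
by rewrite expr0n mul0r scale0r mcoeff0.
Qed.

(** Linearity over the field, not over K[∂]: in a single argument a cochain turns ∂ into a scalar
    that involves the λ_i. *)
Definition klinear V W (h : V -> lpoly W) :=
  forall (c : K) x y, h (c%:P *: x + y) = scal c *: h x + h y.

Lemma klinearD V W (h : V -> lpoly W) :
  klinear h -> {morph h : x y / x + y}.
Proof.
by move=> hl x y; have := hl 1 x y; rewrite Defs.scal1 !scale1r.
Qed.

Lemma klinearZ V W (h : V -> lpoly W) c x :
  klinear h -> h (c%:P *: x) = scal c *: h x.
Proof.
by move=> hl; rewrite -[c%:P *: x]addr0 hl (morph_add0 (klinearD hl)) addr0.
Qed.

(** * Coefficientwise extension *)

Lemma extD V W (h : V -> lpoly W) :
  {morph h : x y / x + y} -> {morph ext h : P Q / P + Q}.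
Proof.
move=> hD; apply: (malg_sumD (F := fun v a => rmono 1 a *: h v)) => m x y.
by rewrite hD scalerDr.
Qed.

Lemma ext_mono V W (h : V -> lpoly W) v a :
  {morph h : x y / x + y} -> ext h (lmono v a) = rmono 1 a *: h v.
Proof.
move=> hD; have FD m : {morph (fun v => rmono 1 m *: h v) : x y / x + y}.
  by move=> x y; rewrite hD scalerDr.
rewrite /ext (_ : lmono v a = << v *g a >>); last by rewrite lmono.unlock.
exact: (malg_sumU FD v a).
Qed.

Lemma ext_cst V W (h : V -> lpoly W) v :
  {morph h : x y / x + y} -> ext h (cst v) = h v.
Proof. by move=> hD; rewrite ext_mono // rmono1 scale1r. Qed.

Lemma eq_ext V W (h h' : V -> lpoly W) P : h =1 h' -> ext h P = ext h' P.
Proof. by move=> hh'; rewrite (_ : h = h') //; apply/funext. Qed.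

Lemma ext0 V W (h : V -> lpoly W) : ext h 0 = 0.
Proof. by rewrite /ext msupp0 big_seq_fset0. Qed.

Lemma ext_fun0 V W (P : lpoly V) : ext (fun=> 0 : lpoly W) P = 0.
Proof. by apply: big1 => m _; rewrite scaler0. Qed.

Lemma ext_funD V W (h h' : V -> lpoly W) P :
  ext (fun x => h x + h' x) P = ext h P + ext h' P.
Proof. by rewrite -big_split; apply: eq_bigr => m _; rewrite scalerDr. Qed.

(* Multiplication by [q] commutes with coefficientwise extension; this holds for
   all the polynomials in the λ_i, but not for ∂. *)
Definition ext_scalar q := forall V W (h : V -> lpoly W) P,
  klinear h -> ext h (q *: P) = q *: ext h P.

Lemma ext_scalar_rmono a : ext_scalar (rmono 1 a).
Proof.
move=> V W h P /klinearD hD.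
apply: (Defs.lpoly_ext (f := fun P => ext h (rmono 1 a *: P))
  (g := fun P => rmono 1 a *: ext h P)) => [x y|x y|v b].
- by rewrite scalerDr extD.
- by rewrite extD // scalerDr.
by rewrite scale_mono scale1r !ext_mono // [RHS]scalerA Defs.rmonoM mulr1.
Qed.

Lemma ext_scalar_lam i : ext_scalar (lam i).
Proof. exact: ext_scalar_rmono. Qed.

Lemma ext_scalar1 : ext_scalar 1.
Proof. by rewrite -rmono1; apply: ext_scalar_rmono. Qed.

Lemma ext_scalar0 : ext_scalar 0.
Proof. by move=> V W h P _; rewrite !scale0r ext0. Qed.

Lemma ext_scalarD p q : ext_scalar p -> ext_scalar q -> ext_scalar (p + q).
Proof.
move=> hp hq V W h P hl.
by rewrite !scalerDl (extD (klinearD hl)) hp // hq.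
Qed.

Lemma ext_scalarN p : ext_scalar p -> ext_scalar (- p).
Proof.
move=> hp V W h P hl.
by rewrite 2!scaleNr (morph_addN (extD (klinearD hl))) hp.
Qed.

Lemma ext_scalarM p q : ext_scalar p -> ext_scalar q -> ext_scalar (p * q).
Proof.
move=> hp hq V W h P hl.
have -> : (p * q) *: P = p *: (q *: P) by rewrite [RHS]scalerA.
by rewrite hp // hq // [LHS]scalerA.
Qed.

Lemma ext_scalar_sum I (r : seq I) (P : pred I) F :
  (forall i, P i -> ext_scalar (F i)) -> ext_scalar (\sum_(i <- r | P i) F i).
Proof.
by move=> FP; apply: big_ind => //; [apply: ext_scalar0 | apply: ext_scalarD].
Qed.

Lemma ext_scalar_mev s a : (forall i, ext_scalar (s i)) -> ext_scalar (mev s a).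
Proof.
move=> sP; apply: big_ind => [||i _].
- exact: ext_scalar1.
- exact: ext_scalarM.
elim: (a i) => [|n IH]; first exact: ext_scalar1.
by rewrite exprS; apply: ext_scalarM.
Qed.

Lemma ext_scalar_scal c : ext_scalar (scal c).
Proof.
move=> V W h P hl; have hD := klinearD hl.
apply: (Defs.lpoly_ext (f := fun P => ext h (scal c *: P))
  (g := fun P => scal c *: ext h P)) => [x y|x y|v b].
- by rewrite scalerDr extD.
- by rewrite extD // scalerDr.
rewrite {1}/scal scale_mono mul1m !ext_mono // klinearZ // [LHS]scalerA.
by rewrite [RHS]scalerA; apply: (congr1 ( *:%R^~ (h v))); apply: mulrC.
Qed.

(** ∂ acts on the coefficients of [P], so it moves into the argument of [h], whereas the λ_i pass
    outside. For a sesquilinear [h] it then reappears as a scalar. *)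
Lemma ext_ddZ V W (h : V -> lpoly W) P : klinear h ->
  ext h (dd *: P) = ext (fun x => h ('X *: x)) P.
Proof.
move=> hl; have hD := klinearD hl.
have hXD : {morph (fun x => h ('X *: x)) : x y / x + y}.
  by move=> x y; rewrite scalerDr hD.
apply: (Defs.lpoly_ext (f := fun P => ext h (dd *: P))
  (g := ext (fun x => h ('X *: x)))) => [x y|x y|v b].
- by rewrite scalerDr extD.
- by rewrite extD.
by rewrite /dd scale_mono mul1m !ext_mono.
Qed.

Lemma ext_funZ V W (h : V -> lpoly W) q P :
  ext (fun x => q *: h x) P = q *: ext h P.
Proof.
rewrite /ext scaler_sumr; apply: eq_bigr => m _.
rewrite [LHS]scalerA [RHS]scalerA.
by apply: (congr1 ( *:%R^~ (h P@_m))); apply: mulrC.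
Qed.

Lemma ext_ext V W X (h : W -> lpoly X) (h' : V -> lpoly W) P :
  klinear h -> ext h (ext h' P) = ext (fun x => ext h (h' x)) P.
Proof.
move=> hl; rewrite {2}/ext (morph_add_sum _ _ _ (extD (klinearD hl))).
by apply: eq_bigr => m _; rewrite ext_scalar_rmono.
Qed.

(** The monomials of [P] and [Q] are commuting scalars. This symmetry is what makes insertions into
    two different arguments commute. *)
Lemma exchange_ext V W X (h : V -> W -> lpoly X) P Q :
  ext (fun x => ext (h x) Q) P = ext (fun y => ext (h^~ y) P) Q.
Proof.
rewrite /ext; under eq_bigr do rewrite scaler_sumr.
rewrite exchange_big; apply: eq_bigr => m _.
rewrite scaler_sumr; apply: eq_bigr => n _ /=.
rewrite [LHS]scalerA [RHS]scalerA.
by apply: (congr1 ( *:%R^~ (h P@_n Q@_m))); apply: mulrC.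
Qed.

End Calculus.

(** * Locked substitution, and its exchange with coefficientwise extension *)

HB.lock Definition lsub {K : fieldType} {V : lmodType {poly K}}
  (s : nat -> lring K) (P : lpoly V) : lpoly V := lsubst s P.
Canonical lsub_unlock := Unlockable lsub.unlock.

Section LockedSubst.
Variable K : fieldType.
Implicit Types (V W : lmodType {poly K}) (s t : nat -> lring K).

Lemma lsubD V s : {morph @lsub K V s : P Q / P + Q}.
Proof. by rewrite unlock; apply: lsubstD. Qed.

Lemma lsub0 V s : lsub s (0 : lpoly V) = 0.
Proof. exact: morph_add0 (lsubD s). Qed.

Lemma lsubZ V s p (P : lpoly V) : lsub s (p *: P) = rsubst s p *: lsub s P.
Proof. by rewrite lsub.unlock; apply: lsubstZ. Qed.

Lemma lsub_cst V s (v : V) : lsub s (cst v) = cst v.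
Proof. by rewrite unlock; apply: lsubst_cst. Qed.

Lemma lsub_lsub V s t (P : lpoly V) :
  lsub s (lsub t P) = lsub (rsubst s \o t) P.
Proof. by rewrite lsub.unlock; apply: lsubst_lsubst. Qed.

Lemma lsub_lam V (P : lpoly V) : lsub lam P = P.
Proof. by rewrite unlock; apply: lsubst_lam. Qed.

Lemma eq_lsub V k s t (P : lpoly V) : in_vars k P ->
  (forall i, (i < k)%N -> s i = t i) -> lsub s P = lsub t P.
Proof. by rewrite lsub.unlock; apply: eq_lsubst. Qed.

Lemma in_vars_lsub V k (P : lpoly V) : in_vars k P <-> lsub (trunc K k) P = P.
Proof. by rewrite unlock; apply: in_varsP. Qed.

Lemma rsubst_scal s c : rsubst s (scal c) = scal c.
Proof. exact: rsubst_rmono. Qed.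

Lemma klinear_lsub V W s (h : V -> lpoly W) :
  klinear h -> klinear (fun x => lsub s (h x)).
Proof. by move=> hl c x y; rewrite hl lsubD lsubZ rsubst_scal. Qed.

(** The substituted monomials of [P] have to leave the extension of [h] as scalars; hence the
    condition that every [s i] be an [ext_scalar], which excludes ∂. *)
Lemma lsub_ext V W s (h : V -> lpoly W) P :
  klinear h -> (forall i, ext_scalar (s i)) ->
  lsub s (ext h P) = ext (fun x => lsub s (h x)) (lsub s P).
Proof.
move=> hl hs; have hD := klinearD hl.
have sl := klinear_lsub s hl; have sD := klinearD sl.
apply: (Defs.lpoly_ext (f := fun P => lsub s (ext h P))
  (g := fun P => ext (fun x => lsub s (h x)) (lsub s P))) => [x y|x y|v a].
- by rewrite (extD hD) lsubD.
- by rewrite lsubD (extD sD).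
rewrite ext_mono // lsubZ [in RHS]lmonoE lsubZ lsub_cst rsubst_mono rmono1 mul1r.
by rewrite (ext_scalar_mev _ hs) // ext_cst.
Qed.

End LockedSubst.

(** * Insertion of cochains *)

(** Signs are kept as parities, so that a sign identity is decided by a case analysis on booleans
    and makes sense in any abelian group. *)
Definition sgn (V : zmodType) (b : bool) (x : V) := if b then - x else x.

Lemma signE (R : pzRingType) (V : lmodType R) k (x : V) :
  (-1) ^+ k *: x = sgn (odd k) x.
Proof. by rewrite -signr_odd scaler_sign. Qed.

Lemma linear_add (R : pzRingType) (V W : lmodType R) (h : V -> W) :
  linear h -> {morph h : x y / x + y}.
Proof. by move=> hl x y; have := hl 1 x y; rewrite !scale1r. Qed.

Lemma linear_scale (R : pzRingType) (V W : lmodType R) (h : V -> W) :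
  linear h -> forall c x, h (c *: x) = c *: h x.
Proof.
by move=> hl c x; rewrite -[c *: x]addr0 hl (morph_add0 (linear_add hl)) addr0.
Qed.

(* The [i]-th term of [circ m n f g], without its sign. *)
HB.lock Definition icirc {K : fieldType} {E : lmodType {poly K}} (i n : nat)
  (f g : cochains E E) : cochains E E := fun u =>
  ext (fun x => lsub (merge_vars K i n) (f (insert i n x u)))
      (lsub (fun j => lam (i + j)) (g (fun j => u (i + j)%N))).
Canonical icirc_unlock := Unlockable icirc.unlock.

Section PartialComposition.
Variables (K : fieldType) (E : lmodType {poly K}).
Implicit Types (f g h : cochains E E) (u : nat -> E).

Lemma cochain_sumE (U V : lmodType {poly K}) I (r : seq I) P
  (F : I -> cochains U V) (u : nat -> U) :
  (\sum_(i <- r | P i) F i) u = \sum_(i <- r | P i) F i u.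
Proof. exact: (morph_add_sum _ _ _ (f := fun f : cochains U V => f u)). Qed.

Lemma circE m n f g :
  circ m n f g = \sum_(i < m) sgn (odd (i * n.-1)) (icirc i n f g).
Proof.
apply/funext => u; rewrite cochain_sumE; apply: eq_bigr => i _.
rewrite signE icirc.unlock lsub.unlock.
by case: odd.
Qed.

Definition multilin (U V : lmodType {poly K}) m (f : cochains U V) :=
  forall i (u : nat -> U), (i < m)%N -> klinear (fun x => f (upd u i x)).

Lemma coch_multilin (U V : lmodType {poly K}) m (f : cochains U V) :
  is_cochain m f -> multilin m f.
Proof. by move=> fc i u im c x y; apply: coch_lin fc _ _ _ _ _ im. Qed.

Lemma insert_upd i n x u : insert i n x u = upd (insert i n 0 u) i x.
Proof. by apply/funext => j; rewrite /insert /upd; case: ltngtP. Qed.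

Lemma klinear_insert m f i n u : multilin m f -> (i < m)%N ->
  klinear (fun x => f (insert i n x u)).
Proof.
move=> fl im c x y.
rewrite (insert_upd i n (c%:P *: x + y)) fl //.
by rewrite (insert_upd i n x) (insert_upd i n y).
Qed.

Lemma ext_scalar_shift i j : ext_scalar (lam (i + j) : lring K).
Proof. exact: ext_scalar_lam. Qed.

Lemma ext_scalar_merge i n j : ext_scalar (merge_vars K i n j).
Proof.
rewrite /merge_vars; case: ltngtP => _; try exact: ext_scalar_lam.
by apply: ext_scalar_sum => k _; apply: ext_scalar_lam.
Qed.

Lemma insert_seq i j n p x y u : (j < n)%N ->
  insert i n y (insert (i + j) p x u) = insert i (n + p).-1 y u.
Proof.
move=> jn; apply/funext => k; rewrite /insert.
case: (ltngtP k i) => [ki|ki|_ //]; first by rewrite ltn_addr.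
have -> : ((k + n).-1 < i + j)%N = false by lia.
have -> : ((k + n).-1 == i + j)%N = false by lia.
by congr u; lia.
Qed.

Lemma shift_insert i j p x u : (0 < p)%N ->
  (fun k => insert (i + j) p x u (i + k)%N) =
  insert j p x (fun k => u (i + k)%N).
Proof.
move=> p0; apply/funext => k; rewrite /insert ltn_add2l eqn_add2l.
by case: ifP => // _; case: ifP => // _; congr u; lia.
Qed.

Lemma sum_merge_lt i p c d : (d <= i)%N ->
  \sum_(c <= t < d) merge_vars K i p t = \sum_(c <= t < d) lam t.
Proof.
move=> di; apply: eq_big_nat => t /andP[_ td].
by rewrite /merge_vars (leq_trans td di).
Qed.

Lemma sum_merge_gt i p c d : (0 < p)%N -> (i < c)%N ->
  \sum_(c <= t < d) merge_vars K i p t =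
  \sum_((c + p).-1 <= t < (d + p).-1) lam t.
Proof.
case: p => // q _ ic; rewrite !addnS /= big_addn addnK.
apply: eq_big_nat => t /andP[ct _]; rewrite /merge_vars.
by case: ltngtP (leq_trans ic ct) => // _ _; rewrite addnS.
Qed.

(** The block λ_i + ... + λ_(i+p-1) put in place of λ_i fills exactly the gap between the unchanged
    variables before it and the shifted ones after it. So a sum over an interval containing i
    remains a sum over an interval. *)
Lemma sum_merge_in i p c d : (0 < p)%N -> (c <= i < d)%N ->
  \sum_(c <= t < d) merge_vars K i p t = \sum_(c <= t < (d + p).-1) lam t.
Proof.
move=> p0 /andP[ci id].
rewrite (big_cat_nat (n := i)) ?(ltnW id) //= sum_merge_lt // big_ltn //.
rewrite sum_merge_gt // {1}/merge_vars ltnn eqxx addSn /=.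
rewrite -(big_cat_nat (n := (i + p)%N)) ?leq_addr //=; last by lia.
by rewrite -big_cat_nat //; lia.
Qed.

Lemma merge_seq i j n p : (j < n)%N -> (0 < p)%N ->
  rsubst (merge_vars K (i + j) p) \o merge_vars K i n =
  merge_vars K i (n + p).-1.
Proof.
move=> jn p0; apply/funext => k; rewrite /= {2 3}/merge_vars.
case: (ltngtP k i) => [ki|ki|_].
- by rewrite rsubst_lam /merge_vars ltn_addr.
- rewrite rsubst_lam /merge_vars.
  have -> : ((k + n).-1 < i + j)%N = false by lia.
  have -> : ((k + n).-1 == i + j)%N = false by lia.
  by congr lam; lia.
rewrite rmorph_sum /=.
under eq_bigr do rewrite rsubst_lam.
rewrite sum_merge_in //; last by lia.
by congr (\sum_(_ <= _ < _) _); lia.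
Qed.

Lemma shift_seq i j p : (0 < p)%N ->
  rsubst (merge_vars K (i + j) p) \o (fun k => lam (i + k)) =
  rsubst (fun k => lam (i + k)) \o merge_vars K j p.
Proof.
move=> p0; apply/funext => k /=.
rewrite rsubst_lam /merge_vars ltn_add2l eqn_add2l.
case: ltngtP => [kj|kj|_]; try by rewrite rsubst_lam; congr lam; lia.
rewrite rmorph_sum /=; under [RHS]eq_bigr do rewrite rsubst_lam.
rewrite -addnA (addnC i j) (addnC i (j + p)) big_addn addnK.
by apply: eq_bigr => t _; rewrite addnC.
Qed.

(** Nested insertion, [h] going into an argument of the inserted [g]. Pushing all substitutions
    inwards writes both sides as iterated extensions over the values of [h]; [ext_ext] regroups
    them, and the substitutions agree by [merge_seq] and [shift_seq]. *)
Lemma icirc_seq m n p i j f g h : multilin m f -> multilin n g ->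
  (i < m)%N -> (j < n)%N -> (0 < p)%N ->
  icirc (i + j) p (icirc i n f g) h = icirc i (n + p).-1 f (icirc j p g h).
Proof.
move=> fl gl im jn p0; apply/funext => u; rewrite icirc.unlock.
set H := lsub _ (h _).
set F := fun y => lsub (merge_vars K i (n + p).-1) (f (insert i (n + p).-1 y u)).
have Fl : klinear F by apply: klinear_lsub; apply: klinear_insert fl im.
transitivity (ext (fun x => ext F (lsub (rsubst (fun k => lam (i + k)) \o
    merge_vars K j p) (g (insert j p x (fun k => u (i + k)%N))))) H).
  apply: eq_ext => x.
  rewrite lsub_ext; first last.
  - exact: ext_scalar_merge.
  - by apply: klinear_lsub; apply: klinear_insert fl im.
  rewrite lsub_lsub shift_seq // shift_insert //.
  by apply: eq_ext => y; rewrite lsub_lsub merge_seq // insert_seq.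
rewrite -ext_ext //; congr ext.
rewrite lsub_ext; first last.
- exact: ext_scalar_shift.
- by apply: klinear_lsub; apply: klinear_insert gl jn.
rewrite lsub_lsub; congr ext.
  by apply/funext => x; rewrite lsub_lsub.
congr (lsub _ (h _)); first by apply/funext => k /=; rewrite rsubst_lam addnA.
by apply/funext => k; rewrite addnA.
Qed.

Lemma insert_par a b n p x y u : (a < b)%N -> (0 < n)%N -> (0 < p)%N ->
  insert b n y (insert a p x u) = insert a p x (insert (b + p).-1 n y u).
Proof.
move=> ab n0 p0; apply/funext => k; rewrite /insert.
case: (ltngtP k a) => [ka|ka|->].
- have -> : (k < b)%N by lia.
  by have -> : (k < (b + p).-1)%N by lia.
- case: (ltngtP k b) => [kb|kb|->].
  + by have -> : ((k + p).-1 < (b + p).-1)%N by lia.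
  + have -> : ((k + n).-1 < a)%N = false by lia.
    have -> : ((k + n).-1 == a)%N = false by lia.
    have -> : ((k + p).-1 < (b + p).-1)%N = false by lia.
    have -> : ((k + p).-1 == (b + p).-1)%N = false by lia.
    by congr u; lia.
  + by rewrite ltnn eqxx.
by rewrite ab.
Qed.

Lemma merge_par a b n p : (a < b)%N -> (0 < n)%N -> (0 < p)%N ->
  rsubst (merge_vars K a p) \o merge_vars K b n =
  rsubst (merge_vars K (b + p).-1 n) \o merge_vars K a p.
Proof.
move=> ab n0 p0; apply/funext => k; rewrite /= {2 4}/merge_vars.
case: (ltngtP k b) => kb; case: (ltngtP k a) => ka; try lia;
  rewrite ?rmorph_sum /= ?rsubst_lam.
- rewrite /merge_vars ka.
  by have -> : (k < (b + p).-1)%N by lia.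
- rewrite /merge_vars.
  have -> : (k < a)%N = false by lia.
  have -> : (k == a)%N = false by lia.
  by have -> : ((k + p).-1 < (b + p).-1)%N by lia.
- under [RHS]eq_bigr do rewrite rsubst_lam.
  rewrite sum_merge_lt; last by lia.
  by rewrite ka /merge_vars ltnn eqxx.
- rewrite /merge_vars.
  have -> : ((k + n).-1 < a)%N = false by lia.
  have -> : ((k + n).-1 == a)%N = false by lia.
  have -> : ((k + p).-1 < (b + p).-1)%N = false by lia.
  have -> : ((k + p).-1 == (b + p).-1)%N = false by lia.
  by congr lam; lia.
- under [LHS]eq_bigr do rewrite rsubst_lam.
  rewrite sum_merge_gt // kb /merge_vars ltnn eqxx.
  by congr (\sum_(_ <= _ < _) _); lia.
Qed.

(** Disjoint insertion, into two different arguments of [f]. Both sides are double extensions over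
    the values of [g] and [h], exchanged by [exchange_ext]. Once [h] occupies p arguments in place
    of argument a < b, argument b has moved to b + p - 1. *)
Lemma icirc_par m n p a b f g h :
  multilin m f -> is_cochain n g -> is_cochain p h ->
  (a < b)%N -> (b < m)%N -> (0 < n)%N -> (0 < p)%N ->
  icirc a p (icirc b n f g) h = icirc (b + p).-1 n (icirc a p f h) g.
Proof.
move=> fl gc hc ab bm n0 p0; apply/funext => u; rewrite icirc.unlock.
have am : (a < m)%N by exact: ltn_trans ab bm.
set G := lsub (fun j => lam ((b + p).-1 + j)) (g _).
set H := lsub _ (h _).
transitivity (ext (fun x => ext (fun y =>
    lsub (rsubst (merge_vars K a p) \o merge_vars K b n)
      (f (insert b n y (insert a p x u)))) G) H).
  apply: eq_ext => x; rewrite lsub_ext; first last.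
  - exact: ext_scalar_merge.
  - by apply: klinear_lsub; apply: klinear_insert fl bm.
  rewrite lsub_lsub; congr ext; last congr lsub.
  - by apply/funext => y; rewrite lsub_lsub.
  - apply/funext => k /=; rewrite rsubst_lam /merge_vars.
    have -> : (b + k < a)%N = false by lia.
    have -> : (b + k == a)%N = false by lia.
    by congr lam; lia.
  - congr g; apply/funext => k; rewrite /insert.
    have -> : (b + k < a)%N = false by lia.
    have -> : (b + k == a)%N = false by lia.
    by congr u; lia.
rewrite exchange_ext; apply: eq_ext => y; rewrite lsub_ext; first last.
- exact: ext_scalar_merge.
- by apply: klinear_lsub; apply: klinear_insert fl am.
rewrite lsub_lsub; congr ext.
  by apply/funext => x; rewrite lsub_lsub merge_par // insert_par.
(* [h] only sees arguments and variables of index at most a + p - 1, below the place b + p - 1 where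
   [g] is inserted. *)
rewrite /H (_ : h _ = h (fun j => u (a + j)%N)).
  apply: (eq_lsub (k := p.-1)) => [|k kp /=]; first exact: (coch_vars hc).
  rewrite rsubst_lam /merge_vars.
  by have -> : (a + k < (b + p).-1)%N by lia.
apply: (coch_arity hc) => k kp; rewrite /insert.
by have -> : (a + k < (b + p).-1)%N by lia.
Qed.

Lemma icirc_linear_l i n g : linear (fun f => icirc i n f g).
Proof.
move=> c f f'; apply/funext => u; rewrite icirc.unlock.
rewrite -[RHS]/(scal c *: ext _ _ + ext _ _) -ext_funZ -ext_funD.
by apply: eq_ext => x; rewrite -(rsubst_scal (merge_vars K i n) c) -lsubZ -lsubD.
Qed.

Lemma icirc_linear_r m i n f : multilin m f -> (i < m)%N ->
  linear (icirc i n f : cochains E E -> cochains E E).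
Proof.
move=> fl im c g g'; apply/funext => u; rewrite icirc.unlock.
have Fl := klinear_lsub (merge_vars K i n) (klinear_insert n u fl im).
rewrite -[RHS]/(scal c *: ext _ _ + ext _ _) -(ext_scalar_scal _ _ Fl).
rewrite -(extD (klinearD Fl)); congr ext.
by rewrite -[in RHS](rsubst_scal (fun j => lam (i + j)) c) -lsubZ -lsubD.
Qed.

Lemma circ_linear_l m n g : linear (fun f => circ m n f g).
Proof.
move=> c f f'; rewrite !circE scaler_sumr -big_split; apply: eq_bigr => i _ /=.
by rewrite (icirc_linear_l i n g) /sgn; case: odd; rewrite // scalerN opprD.
Qed.

Lemma circ_linear_r m n f : multilin m f ->
  linear (circ m n f : cochains E E -> cochains E E).
Proof.
move=> fl c g g'; rewrite !circE scaler_sumr -big_split; apply: eq_bigr => i _ /=.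
by rewrite (icirc_linear_r n fl) // /sgn; case: odd; rewrite // scalerN opprD.
Qed.

Lemma gerst_linear_l m n g : multilin n g -> linear (fun f => gerst m n f g).
Proof.
move=> gl c f f'; rewrite /gerst (circ_linear_l _ _ g) (circ_linear_r m gl) !signE.
by rewrite /sgn; case: odd; rewrite !scalerDr ?scalerN !opprD ?opprK addrACA.
Qed.

Lemma gerst_linear_r m n f : multilin m f ->
  linear (gerst m n f : cochains E E -> cochains E E).
Proof.
move=> fl c g g'; rewrite /gerst (circ_linear_l _ _ f) (circ_linear_r n fl) !signE.
by rewrite /sgn; case: odd; rewrite !scalerDr ?scalerN !opprD ?opprK addrACA.
Qed.

End PartialComposition.

(** * The graded Jacobi identity *)

Section Signs.
Variable V : zmodType.
Implicit Types (x y : V) (b c : bool).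

Lemma sgnD b : {morph @sgn V b : x y / x + y}.
Proof. by move=> x y; case: b; rewrite //= opprD. Qed.

Lemma sgnN b : {morph @sgn V b : x / - x}.
Proof. exact: morph_addN (sgnD b). Qed.

Lemma sgn0 b : sgn b (0 : V) = 0.
Proof. by case: b; rewrite //= oppr0. Qed.

Lemma sgn_sgn b c x : sgn b (sgn c x) = sgn (b (+) c) x.
Proof. by case: b; case: c => //=; rewrite opprK. Qed.

Lemma sgn_sum b I (r : seq I) (P : pred I) (F : I -> V) :
  sgn b (\sum_(i <- r | P i) F i) = \sum_(i <- r | P i) sgn b (F i).
Proof. exact: morph_add_sum (sgnD b). Qed.

End Signs.

Lemma morph_sgn (V W : zmodType) (f : V -> W) b :
  {morph f : x y / x + y} -> {morph f : x / sgn b x}.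
Proof. by move=> fD x; case: b => //=; rewrite (morph_addN fD). Qed.

(* [zmod env] proves the equalities valid in every abelian group with generators
   [env]; [ring] does not apply to a mere zmodType. *)
Inductive zexpr := ZVar of nat | ZAdd of zexpr & zexpr | ZOpp of zexpr.

Fixpoint zeval (V : zmodType) (env : seq V) e : V :=
  match e with
  | ZVar n => env`_n
  | ZAdd e1 e2 => zeval env e1 + zeval env e2
  | ZOpp e1 => - zeval env e1
  end.

Fixpoint zcoef e (i : nat) : int :=
  match e with
  | ZVar n => (i == n)%:Z
  | ZAdd e1 e2 => zcoef e1 i + zcoef e2 i
  | ZOpp e1 => - zcoef e1 i
  end.

(** The normal form behind [zmod]. A variable beyond the environment evaluates to the default 0 and
    occurs in no summand. *)
Lemma zevalE (V : zmodType) (env : seq V) e :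
  zeval env e = \sum_(i < size env) env`_i *~ zcoef e i.
Proof.
elim: e => [n|e1 IH1 e2 IH2|e IH] /=.
- have [n_lt|n_ge] := ltnP n (size env).
    rewrite (bigD1 (Ordinal n_lt)) //= eqxx mulr1z big1 ?addr0 // => i.
    by rewrite -val_eqE /= => /negPf ->.
  rewrite nth_default // big1 // => i _.
  by rewrite (ltn_eqF (leq_trans (ltn_ord i) n_ge)).
- by rewrite IH1 IH2 -big_split; apply: eq_bigr => i _; rewrite mulrzDr.
- by rewrite IH -sumrN; apply: eq_bigr => i _; rewrite mulrNz.
Qed.

Lemma zeval_eq (V : zmodType) (env : seq V) e1 e2 :
  all (fun i => zcoef e1 i == zcoef e2 i) (iota 0 (size env)) ->
  zeval env e1 = zeval env e2.
Proof.
move=> /allP e12; rewrite !zevalE; apply: eq_bigr => i _.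
by rewrite (eqP (e12 i _)) // mem_iota ltn_ord.
Qed.

Ltac zindex x env :=
  match env with
  | x :: _ => constr:(0%N)
  | _ :: ?env' => let n := zindex x env' in constr:(n.+1)
  end.

Ltac zquote env t :=
  match t with
  | ?a + ?b => let ea := zquote env a in let eb := zquote env b in
               constr:(ZAdd ea eb)
  | - ?a => let ea := zquote env a in constr:(ZOpp ea)
  | _ => let n := zindex t env in constr:(ZVar n)
  end.

Ltac zmod env :=
  match goal with
  | |- ?l = ?r => let el := zquote env l in let er := zquote env r in
                  apply: (zeval_eq (env := env) (e1 := el) (e2 := er))
  end; by [].

(* [fgh] stands for [(f g) h], [fgh'] for [f (g h)], and [a], [b], [c] for the
   parities of the products of the degrees of [f] and [g], [g] and [h], [f] and
   [h]. *)
Lemma jacobi_of_prelie (V : zmodType) (a b c : bool)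
    (fgh fgh' fhg fhg' gfh gfh' ghf ghf' hfg hfg' hgf hgf' : V) :
  fgh - fgh' = sgn b (fhg - fhg') ->
  gfh - gfh' = sgn c (ghf - ghf') ->
  hfg - hfg' = sgn a (hgf - hgf') ->
  (fgh' - sgn b fhg') - sgn (a (+) c) (ghf - sgn b hgf) =
  (fgh - sgn a gfh) - sgn (c (+) b) (hfg' - sgn a hgf') +
  sgn a ((gfh' - sgn c ghf') - sgn (a (+) b) (fhg - sgn c hfg)).
Proof.
move=> /(canRL (subrK _)) -> /(canRL (subrK _)) -> /(canRL (subrK _)) ->.
by case: a; case: b; case: c => /=;
  zmod [:: fgh'; fhg; fhg'; gfh'; ghf; ghf'; hfg'; hgf; hgf'].
Qed.

Lemma exchange_triangle (V : zmodType) m (F : nat -> nat -> V) :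
  \sum_(0 <= b < m) \sum_(0 <= a < b) F a b =
  \sum_(0 <= a < m) \sum_(a.+1 <= b < m) F a b.
Proof.
transitivity (\sum_(0 <= b < m) \sum_(0 <= a < m | (a < b)%N) F a b).
  by apply: eq_big_nat => b bm; rewrite (big_nat_widen _ _ m) // ltnW.
rewrite (exchange_big_dep_nat xpredT) //=; apply: eq_big_nat => a _.
by rewrite [RHS](big_nat_widenl _ 0%N).
Qed.

(** For an insertion at k into [f] with an (n+1)-ary [g] already in slot i: k < i is an argument of
    [f] before [g], k = i + j with j <= n is an argument of [g], and k = b + n with b > i is an
    argument b of [f] after [g]. *)
Lemma split_composition_sum (V : zmodType) m n (F : nat -> nat -> V) :
  \sum_(0 <= i < m) \sum_(0 <= k < m + n) F i k =
  \sum_(0 <= i < m) \sum_(0 <= a < i) F i a +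
  \sum_(0 <= i < m) \sum_(0 <= j < n.+1) F i (i + j)%N +
  \sum_(0 <= i < m) \sum_(i.+1 <= b < m) F i (b + n)%N.
Proof.
rewrite -!big_split; apply: eq_big_nat => i /andP[_ im].
rewrite (big_cat_nat (n := i)) //=; last by lia.
rewrite (big_cat_nat (m := i) (n := (i + n.+1)%N)) //=; try lia.
rewrite addrA; congr (_ + _ + _).
  by rewrite -{1}(add0n i) big_addn addKn; apply: eq_bigr => j _; rewrite addnC.
by rewrite addnS -addSn big_addn addnK.
Qed.

Section GradedLie.
Variables (K : fieldType) (E : lmodType {poly K}).
Implicit Types (f g h : cochains E E).

Lemma gerstE m n f g : gerst m.+1 n.+1 f g =
  circ m.+1 n.+1 f g - sgn (odd (m * n)) (circ n.+1 m.+1 g f).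
Proof. by rewrite /gerst signE /=; case: odd. Qed.

Lemma circ_nat m n f g : circ m n.+1 f g =
  \sum_(0 <= i < m) sgn (odd (i * n)) (icirc i n.+1 f g).
Proof. by rewrite circE big_mkord. Qed.

Let term (n p : nat) f g h i k : cochains E E :=
  sgn (odd (k * p) (+) odd (i * n)) (icirc k p.+1 (icirc i n.+1 f g) h).

(** Of the three ranges of [split_composition_sum], the middle one is [f ∘ (g ∘ h)] by [icirc_seq].
    What survives are the terms with [g] and [h] in two different arguments of [f]. *)
Lemma associator_circ m n p f g h :
  multilin m f -> is_cochain n.+1 g -> is_cochain p.+1 h ->
  circ (m + n) p.+1 (circ m n.+1 f g) h - circ m (n + p).+1 f (circ n.+1 p.+1 g h)
  = \sum_(0 <= i < m) \sum_(0 <= a < i) term n p f g h i a +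
    \sum_(0 <= i < m) \sum_(i.+1 <= b < m) term n p f g h i (b + n).
Proof.
move=> fl gc hc.
have -> : circ (m + n) p.+1 (circ m n.+1 f g) h =
    \sum_(0 <= i < m) \sum_(0 <= k < m + n) term n p f g h i k.
  rewrite exchange_big_nat circ_nat; apply: eq_big_nat => k _.
  rewrite circ_nat (morph_add_sum _ _ _ (linear_add (icirc_linear_l k p.+1 h))).
  rewrite sgn_sum.
  apply: eq_big_nat => i _.
  by rewrite (morph_sgn _ (linear_add (icirc_linear_l k p.+1 h))) sgn_sgn.
have -> : circ m (n + p).+1 f (circ n.+1 p.+1 g h) =
    \sum_(0 <= i < m) \sum_(0 <= j < n.+1) term n p f g h i (i + j).
  rewrite circ_nat; apply: eq_big_nat => i /andP[_ im].
  have fD := linear_add (icirc_linear_r (n + p).+1 fl im).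
  rewrite circ_nat (morph_add_sum _ _ _ fD) sgn_sum.
  apply: eq_big_nat => j /andP[_ jn]; rewrite (morph_sgn _ fD) sgn_sgn /term.
  rewrite (icirc_seq h fl (coch_multilin gc) im jn) // addSn addnS /=.
  have -> // : odd ((i + j) * p) (+) odd (i * n) = odd (i * (n + p)) (+) odd (j * p).
  by rewrite mulnDl mulnDr !oddD; do 3!case: (odd _).
by rewrite split_composition_sum addrAC addrK.
Qed.

(** The associator is a sum over pairs of distinct arguments of [f], so it is graded symmetric in
    [g] and [h]. *)
Lemma prelie_circ m n p f g h :
  multilin m f -> is_cochain n.+1 g -> is_cochain p.+1 h ->
  circ (m + n) p.+1 (circ m n.+1 f g) h - circ m (n + p).+1 f (circ n.+1 p.+1 g h)
  = sgn (odd (n * p)) (circ (m + p) n.+1 (circ m p.+1 f h) g -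
                       circ m (n + p).+1 f (circ p.+1 n.+1 h g)).
Proof.
move=> fl gc hc.
(* Disjoint insertion carries the terms with [h1] before [g1] to those of the exchanged composition;
   the shift of the slot from b to b + p1 produces the sign of parity n1 * p1. *)
have swap n1 p1 g1 h1 : is_cochain n1.+1 g1 -> is_cochain p1.+1 h1 ->
    \sum_(0 <= i < m) \sum_(0 <= a < i) term n1 p1 f g1 h1 i a =
    sgn (odd (n1 * p1))
      (\sum_(0 <= i < m) \sum_(i.+1 <= b < m) term p1 n1 f h1 g1 i (b + p1)).
  move=> g1c h1c; rewrite (exchange_triangle _ (fun a b => term n1 p1 f g1 h1 b a)).
  rewrite sgn_sum; apply: eq_big_nat => a _.
  rewrite sgn_sum; apply: eq_big_nat => b /andP[ab bm].
  rewrite /term sgn_sgn (icirc_par fl g1c h1c ab bm) // addnS /=.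
  have -> // : odd (n1 * p1) (+) (odd ((b + p1) * n1) (+) odd (a * p1)) =
    odd (a * p1) (+) odd (b * n1).
  by rewrite mulnDl !oddD (mulnC p1); do 3!case: (odd _).
rewrite (associator_circ fl gc hc) (addnC n p) (associator_circ fl hc gc).
rewrite (swap n p) // (swap p n) // sgnD sgn_sgn mulnC addbb /=.
by rewrite addrC.
Qed.

(** By linearity the double brackets expand into the twelve triple compositions of
    [jacobi_of_prelie], related by the pre-Lie identities with [f], [g] and [h] in the outer
    position. *)
Lemma jacobi_gerst m n p f g h :
  is_cochain m.+1 f -> is_cochain n.+1 g -> is_cochain p.+1 h ->
  gerst m.+1 (n + p).+1 f (gerst n.+1 p.+1 g h) =
  gerst (m + n).+1 p.+1 (gerst m.+1 n.+1 f g) h +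
  sgn (odd (m * n)) (gerst n.+1 (m + p).+1 g (gerst m.+1 p.+1 f h)).
Proof.
move=> fc gc hc.
have [[fl gl] hl] := (coch_multilin fc, coch_multilin gc, coch_multilin hc).
have := prelie_circ hl fc gc; have := prelie_circ gl fc hc.
have := prelie_circ fl gc hc; rewrite !addSn (addnC n m) (addnC p m) (addnC p n).
move=> Hf Hg Hh.
have circB k q f1 f2 g1 : circ k q (f1 - f2) g1 = circ k q f1 g1 - circ k q f2 g1.
  have fD := linear_add (circ_linear_l k q g1).
  by rewrite (fD f1 (- f2)) (morph_addN fD).
have lD k q g1 := linear_add (circ_linear_l k q g1).
have rD k q f1 (f1l : multilin k f1) := linear_add (circ_linear_r q f1l).
rewrite !gerstE !circB.
rewrite !(rD _ _ _ fl) !(rD _ _ _ gl) !(rD _ _ _ hl).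
rewrite !(morph_addN (rD _ _ _ fl)) !(morph_addN (rD _ _ _ gl)).
rewrite !(morph_addN (rD _ _ _ hl)).
rewrite !(morph_sgn _ (rD _ _ _ fl)) !(morph_sgn _ (rD _ _ _ gl)).
rewrite !(morph_sgn _ (rD _ _ _ hl)).
rewrite !(morph_sgn _ (lD _ _ f)) !(morph_sgn _ (lD _ _ g)).
rewrite !(morph_sgn _ (lD _ _ h)).
rewrite mulnDr mulnDl mulnDr !oddD (mulnC n m).
exact: jacobi_of_prelie Hf Hg Hh.
Qed.

End GradedLie.

(** * Sesquilinearity of the compositions *)

Section CochainClosure.
Variables (K : fieldType).
Implicit Types (U V E : lmodType {poly K}).

Lemma upd_id U (u : nat -> U) i : upd u i (u i) = u.
Proof. by apply/funext => j; rewrite /upd; case: eqP => [->|]. Qed.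

Lemma upd_upd U (u : nat -> U) i x y : upd (upd u i x) i y = upd u i y.
Proof. by apply/funext => j; rewrite /upd; case: eqP. Qed.

Lemma updE U (u : nat -> U) i x : upd u i x i = x.
Proof. by rewrite /upd eqxx. Qed.

(* The action of ∂ on the [j]-th argument of an [n]-cochain: these scalars add up
   to ∂. *)
Definition dact n j : lring K :=
  if (j < n.-1)%N then - lam j else dd + \sum_(0 <= k < n.-1) lam k.

Lemma coch_dact U V n (f : cochains U V) u j x : is_cochain n f -> (j < n)%N ->
  f (upd u j ('X *: x)) = dact n j *: f (upd u j x).
Proof.
move=> fc jn; rewrite /dact; case: ifP => jn1.
  have := coch_dd fc (upd u j x) jn1.
  by rewrite upd_upd updE.
have -> : j = n.-1 by lia.
have := coch_ddlast fc (upd u n.-1 x).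
by rewrite upd_upd updE big_mkord.
Qed.

(** The conditions on ∂ for the last argument and for the others become one, stated through
    [dact]. *)
Lemma is_cochain_dact U V n (f : cochains U V) : (0 < n)%N ->
  (forall u v, (forall j, (j < n)%N -> u j = v j) -> f u = f v) ->
  (forall u, in_vars n.-1 (f u)) ->
  (forall u i, (i < n)%N -> klinear (fun x => f (upd u i x))) ->
  (forall u i x, (i < n)%N ->
     f (upd u i ('X *: x)) = dact n i *: f (upd u i x)) ->
  is_cochain n f.
Proof.
move=> n0 far fvars flin fdact; split => // [u i c x y|u i|u].
- by move/flin; apply.
- move=> in1; rewrite fdact ?upd_id; last by lia.
  by rewrite /dact in1.
- rewrite fdact ?upd_id; last by lia.
  by rewrite /dact ltnn big_mkord.
Qed.

Lemma in_vars0 V k : in_vars k (0 : lpoly V).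
Proof. by apply/in_vars_lsub; rewrite lsub0. Qed.

Lemma in_varsD V k (P Q : lpoly V) : in_vars k P -> in_vars k Q -> in_vars k (P + Q).
Proof.
by move=> /in_vars_lsub Pk /in_vars_lsub Qk; apply/in_vars_lsub; rewrite lsubD Pk Qk.
Qed.

Lemma in_vars_scal V k c (P : lpoly V) : in_vars k P -> in_vars k (scal c *: P).
Proof.
by move=> /in_vars_lsub Pk; apply/in_vars_lsub; rewrite lsubZ rsubst_scal Pk.
Qed.

Lemma is_cochain0 U V n : is_cochain n (0 : cochains U V).
Proof.
split=> [//|u|u i c x y _|u i _|u]; rewrite ?scaler0 //; first exact: in_vars0.
by rewrite add0r.
Qed.

Lemma scal_comm V (c : K) q (P : lpoly V) : scal c *: (q *: P) = q *: (scal c *: P).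
Proof.
rewrite [LHS]scalerA [RHS]scalerA.
by apply: (congr1 ( *:%R^~ P)); apply: mulrC.
Qed.

Lemma is_cochain_lin U V n (c : K) (f g : cochains U V) :
  is_cochain n f -> is_cochain n g -> is_cochain n (c *: f + g).
Proof.
move=> fc gc; split=> [u v uv|u|u i d x y ilt|u i ilt|u];
  rewrite -?[(c *: f + g) _]/(scal c *: f _ + g _).
- by rewrite (coch_arity fc uv) (coch_arity gc uv).
- by apply: in_varsD; [apply/in_vars_scal/(coch_vars fc) | apply: (coch_vars gc)].
- rewrite (coch_lin fc) // (coch_lin gc) //.
  by rewrite !scalerDr scal_comm addrACA.
- by rewrite (coch_dd fc) // (coch_dd gc) // scal_comm scalerDr.
- by rewrite (coch_ddlast fc) (coch_ddlast gc) scal_comm [RHS]scalerDr.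
Qed.

Lemma is_cochainD U V n (f g : cochains U V) :
  is_cochain n f -> is_cochain n g -> is_cochain n (f + g).
Proof. by move=> fc gc; rewrite -[f]scale1r; apply: is_cochain_lin. Qed.

Lemma is_cochain_sgn U V n b (f : cochains U V) :
  is_cochain n f -> is_cochain n (sgn b f).
Proof.
move=> fc; case: b => //=; rewrite -[- f]addr0 -scaleN1r.
exact: is_cochain_lin (is_cochain0 _ _ _).
Qed.

Lemma ext_scalar_trunc k i : ext_scalar (trunc K k i).
Proof.
by rewrite /trunc; case: ifP => _; [apply: ext_scalar_lam | apply: ext_scalar0].
Qed.

Lemma rsubst_trunc_sum N c d : (d <= N)%N ->
  rsubst (trunc K N) (\sum_(c <= k < d) lam k) = \sum_(c <= k < d) lam k.
Proof.
move=> dN; rewrite rmorph_sum; apply: eq_big_nat => k /andP[_ kd] /=.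
by rewrite rsubst_lam /trunc (leq_trans kd dN).
Qed.

Lemma merge_dact m n i j : (i < m)%N -> (j < m)%N -> j != i ->
  rsubst (merge_vars K i n.+1) (dact m j) =
  dact (m + n) (if (j < i)%N then j else j + n).
Proof.
move=> im jm ji; rewrite {1}/dact; case: ifP => jm1.
  rewrite rmorphN /= rsubst_lam /dact /merge_vars !addnS /= (negPf ji).
  case: ifP => ji'; first by have -> : (j < (m + n).-1)%N by lia.
  by have -> : (j + n < (m + n).-1)%N by lia.
have {jm1} jE : j = m.-1 by lia.
have {ji} im1 : (i < m.-1)%N by lia.
have -> : (j < i)%N = false by lia.
rewrite rmorphD /= rsubst_dd rmorph_sum /=.
under eq_bigr do rewrite rsubst_lam.
rewrite sum_merge_in // addnS /= jE /dact.
have -> : (m.-1 + n < (m + n).-1)%N = false by lia.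
by have -> : (m.-1 + n = (m + n).-1)%N by lia.
Qed.

(** ∂ on the last argument of [g] becomes ∂ + λ_i + ... + λ_(i+n-1) on its value, and this ∂ enters
    slot i of [f]. If that slot is not the last one, it yields minus the whole block, of which only
    - λ_(i+n) is left. *)
Lemma merge_dact_last m n i : (i < m)%N ->
  \sum_(0 <= k < n) lam (i + k) + rsubst (merge_vars K i n.+1) (dact m i) =
  dact (m + n) (i + n).
Proof.
move=> im; rewrite /dact; case: ifP => im1.
  have -> : (i + n < (m + n).-1)%N by lia.
  rewrite rmorphN /= rsubst_lam /merge_vars ltnn eqxx addnS.
  rewrite big_nat_recr ?leq_addr //=.
  rewrite opprD addrA -{2}(add0n i) big_addn addKn.
  by under eq_bigr do rewrite addnC; rewrite subrr add0r.
have -> : (i + n < (m + n).-1)%N = false by lia.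
have iE : i = m.-1 by lia.
rewrite rmorphD /= rsubst_dd rmorph_sum /= addrC.
under eq_bigr do rewrite rsubst_lam.
rewrite sum_merge_lt ?iE // -addrA; congr (_ + _).
have -> : (m + n).-1 = (m.-1 + n)%N by lia.
rewrite [RHS](big_cat_nat (n := m.-1)) ?leq_addr //=; congr (_ + _).
by rewrite -{2}(add0n m.-1) big_addn addKn; under [RHS]eq_bigr do rewrite addnC.
Qed.

Lemma insert_upd_out U i n j x y (u : nat -> U) : j != i ->
  insert i n.+1 x (upd u (if (j < i)%N then j else j + n) y) =
  upd (insert i n.+1 x u) j y.
Proof.
move=> ji; apply/funext => k; rewrite /insert /upd addnS /=.
case: (ltngtP k i) => ki; case: (ltngtP j i) ji => // ij _.
- have -> : (k == j + n)%N = false by lia.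
  by have -> : (k == j)%N = false by lia.
- have -> : (k + n == j)%N = false by lia.
  by have -> : (k == j)%N = false by lia.
- by rewrite eqn_add2r.
- by have -> : (k == j)%N = false by lia.
- by have -> : (k == j)%N = false by lia.
Qed.

Lemma insert_upd_in U i n j x y (u : nat -> U) : (j <= n)%N ->
  insert i n.+1 x (upd u (i + j) y) = insert i n.+1 x u.
Proof.
move=> jn; apply/funext => k; rewrite /insert /upd addnS /=.
case: (ltngtP k i) => ki //.
- by have -> : (k == i + j)%N = false by lia.
- by have -> : (k + n == i + j)%N = false by lia.
Qed.

Section Icirc.
Variables (E : lmodType {poly K}) (m n i : nat) (f g : cochains E E).
Hypotheses (fc : is_cochain m f) (gc : is_cochain n.+1 g) (im : (i < m)%N).

Let F u x := lsub (merge_vars K i n.+1) (f (insert i n.+1 x u)).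
Let G u := lsub (fun j => lam (i + j)) (g (fun j => u (i + j)%N)).
Let Fl u : klinear (F u).
Proof. exact/klinear_lsub/(klinear_insert n.+1 u (coch_multilin fc)). Qed.

Let icE u : icirc i n.+1 f g u = ext (F u) (G u).
Proof. by rewrite unlock. Qed.

Let FX u x : F u ('X *: x) = rsubst (merge_vars K i n.+1) (dact m i) *: F u x.
Proof.
by rewrite /F (insert_upd i _ ('X *: x)) (coch_dact _ _ fc im) lsubZ -insert_upd.
Qed.

Let icirc_in_vars u : in_vars (m + n).-1 (icirc i n.+1 f g u).
Proof.
apply/in_vars_lsub; rewrite icE lsub_ext //; last exact: ext_scalar_trunc.
rewrite /G lsub_lsub; congr ext.
  apply/funext => x; rewrite /F lsub_lsub.
  apply: (eq_lsub (k := m.-1)) => [|k km /=]; first exact: (coch_vars fc).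
  rewrite /merge_vars; case: (ltngtP k i) => ki.
  - by rewrite rsubst_lam /trunc; have -> : (k < (m + n).-1)%N by lia.
  - by rewrite rsubst_lam /trunc; have -> : ((k + n.+1).-1 < (m + n).-1)%N by lia.
  - by rewrite rsubst_trunc_sum //; lia.
apply: (eq_lsub (k := n)) => [|k kn /=]; first exact: (coch_vars gc).
by rewrite rsubst_lam /trunc; have -> : (i + k < (m + n).-1)%N by lia.
Qed.

(** An argument of the composition belongs to [g], or is an argument of [f] other than slot i;
    sesquilinearity is checked separately in the two cases. *)
Let arg_cases (j : nat) : (j < m + n)%N ->
  (exists2 k, (k <= n)%N & j = i + k)%N \/
  (exists k, [/\ k < m, k != i & j = if k < i then k else k + n])%N.
Proof.
move=> jN; case: (ltnP j i) => ji.
  by right; exists j; rewrite ji; split; lia.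
case: (leqP j (i + n)) => jin; first by left; exists (j - i)%N; lia.
by right; exists (j - n)%N; split; [lia|lia|case: ifP; lia].
Qed.

Let icirc_in k y u : (k <= n)%N ->
  icirc i n.+1 f g (upd u (i + k) y) =
  ext (F u) (lsub (fun j => lam (i + j)) (g (upd (fun j => u (i + j)%N) k y))).
Proof.
move=> kn; rewrite icE; congr ext.
  by apply/funext => x; rewrite /F insert_upd_in.
congr (lsub _ (g _)); apply/funext => j.
by rewrite /upd eqn_add2l.
Qed.

Let icirc_out k y u : k != i ->
  icirc i n.+1 f g (upd u (if (k < i)%N then k else k + n) y) =
  ext (fun x => lsub (merge_vars K i n.+1) (f (upd (insert i n.+1 x u) k y))) (G u).
Proof.
move=> ki; rewrite icE; congr ext.
  by apply/funext => x; rewrite /F insert_upd_out.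
congr lsub; apply: (coch_arity gc) => j jn; rewrite /upd.
have -> // : (i + j == if (k < i)%N then k else k + n)%N = false.
by case: ifP => ki'; lia.
Qed.

Lemma is_cochain_icirc : is_cochain (m + n) (icirc i n.+1 f g).
Proof.
apply: is_cochain_dact => [|u v uv||u j jN|u j x jN].
- by lia.
- rewrite !icE; congr ext.
    apply/funext => x; congr lsub; apply: (coch_arity fc) => k km.
    by rewrite /insert; case: ltngtP => // ki; apply: uv; lia.
  by congr lsub; apply: (coch_arity gc) => k kn; apply: uv; lia.
- exact: icirc_in_vars.
- case: (arg_cases jN) => [[k kn ->]|[k [km ki ->]]] c x y.
    rewrite !icirc_in // (coch_lin gc) // lsubD lsubZ rsubst_scal.
    by rewrite (extD (klinearD (Fl u))) (ext_scalar_scal c _ (Fl u)).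
  rewrite !icirc_out // -ext_funZ -ext_funD; apply: eq_ext => z.
  by rewrite (coch_lin fc) // lsubD lsubZ rsubst_scal.
case: (arg_cases jN) => [[k kn ->]|[k [km ki ->]]].
  rewrite !icirc_in // (coch_dact _ _ gc) // lsubZ.
  set P := lsub _ _; rewrite {1}/dact /=; case: ifP => kn1.
    rewrite rmorphN /= rsubst_lam (ext_scalarN (ext_scalar_lam _) _ (Fl u)).
    by rewrite /dact; have -> : (i + k < (m + n).-1)%N by lia.
  (* The last argument of [g] is the delicate case: ∂ acts on the value of [g], hence passes to slot
     i of [f] by [FX]. *)
  have -> : k = n by lia.
  rewrite -merge_dact_last // rmorphD /= rsubst_dd rmorph_sum /=.
  under eq_bigr do rewrite rsubst_lam.
  rewrite scalerDl (extD (klinearD (Fl u))) (ext_ddZ _ (Fl u)).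
  rewrite ext_scalar_sum //; last by move=> *; apply: ext_scalar_lam.
  rewrite [RHS]scalerDl addrC; congr (_ + _).
  by rewrite -ext_funZ; apply: eq_ext => z; rewrite FX.
rewrite !icirc_out // -merge_dact // -ext_funZ; apply: eq_ext => z.
by rewrite (coch_dact _ _ fc) // lsubZ.
Qed.

End Icirc.

Lemma is_cochain_circ E m n (f g : cochains E E) : (0 < m)%N ->
  is_cochain m f -> is_cochain n.+1 g -> is_cochain (m + n) (circ m n.+1 f g).
Proof.
move=> m0 fc gc; rewrite circE; apply: big_ind => [||i _].
- exact: is_cochain0.
- exact: is_cochainD.
- exact/is_cochain_sgn/is_cochain_icirc.
Qed.

Lemma is_cochain_gerst E m n (f g : cochains E E) :
  is_cochain m.+1 f -> is_cochain n.+1 g ->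
  is_cochain (m + n).+1 (gerst m.+1 n.+1 f g).
Proof.
move=> fc gc; rewrite gerstE -sgnN; apply: is_cochainD.
  exact: is_cochain_circ fc gc.
rewrite sgnN -[- sgn _ _]/(sgn true _) addnC.
exact/is_cochain_sgn/is_cochain_sgn/(is_cochain_circ _ gc fc).
Qed.

End CochainClosure.

(** * Coefficientwise linear maps *)

Section Lmap.
Variable K : fieldType.
Implicit Types (U V W X Y Z : lmodType {poly K}).

Lemma lmap_klinear V W (h : V -> W) : linear h -> klinear (fun v => cst (h v)).
Proof. by move=> hl c x y; rewrite hl cst_is_additive cstZ. Qed.

Lemma lmapD V W (h : V -> W) : linear h -> {morph lmap h : P Q / P + Q}.
Proof. by move=> hl; apply: extD; apply/klinearD/lmap_klinear. Qed.

Lemma lmap_cst V W (h : V -> W) v : linear h -> lmap h (cst v) = cst (h v).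
Proof. by move=> hl; apply: ext_cst; apply/klinearD/lmap_klinear. Qed.

Lemma lmap_mono V W (h : V -> W) v a : linear h ->
  lmap h (lmono v a) = lmono (h v) a.
Proof.
move=> hl; rewrite [RHS]lmonoE; apply: ext_mono.
exact/klinearD/lmap_klinear.
Qed.

Lemma lmapZ V W (h : V -> W) q P : linear h -> lmap h (q *: P) = q *: lmap h P.
Proof.
move=> hl; have hD := lmapD hl; have hZ := linear_scale hl.
apply: (Defs.lpoly_ext (f := fun P => lmap h (q *: P))
  (g := fun P => q *: lmap h P)) => [x y|x y|v b].
- by rewrite scalerDr hD.
- by rewrite hD scalerDr.
apply: (Defs.lring_ext (f := fun q => lmap h (q *: _)) (g := fun q => q *: _))
  => [x y|x y|c a].
- by rewrite scalerDl hD.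
- by rewrite scalerDl.
by rewrite scale_mono !lmap_mono // scale_mono hZ.
Qed.

Lemma lmap_id V (P : lpoly V) : lmap id P = P.
Proof.
have idl : linear (id : V -> V) by [].
apply: (Defs.lpoly_ext (g := id)) => [x y|//|v a]; first exact: lmapD.
by rewrite lmap_mono.
Qed.

Lemma ext_lmap V W X (h : W -> lpoly X) (k : V -> W) P :
  klinear h -> linear k -> ext h (lmap k P) = ext (fun x => h (k x)) P.
Proof.
move=> hl kl; rewrite ext_ext //; apply: eq_ext => x.
by rewrite ext_cst //; apply: klinearD.
Qed.

Lemma lmap_ext V W X (h : W -> X) (k : V -> lpoly W) P :
  linear h -> lmap h (ext k P) = ext (fun x => lmap h (k x)) P.
Proof. by move=> hl; apply: ext_ext; apply: lmap_klinear. Qed.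

Lemma lmap_lmap V W X (h : W -> X) (k : V -> W) P :
  linear h -> linear k -> lmap h (lmap k P) = lmap (h \o k) P.
Proof. by move=> hl kl; rewrite [LHS]ext_lmap //; apply: lmap_klinear. Qed.

Lemma lmap_fun0 V W (P : lpoly V) : lmap (fun=> 0 : W) P = 0.
Proof.
rewrite -[RHS](ext_fun0 W P); apply: eq_ext => x.
exact: morph_add0 (@cst_is_additive _ _).
Qed.

Lemma lsub_lmap V W (h : V -> W) s P : linear h ->
  lsub s (lmap h P) = lmap h (lsub s P).
Proof.
move=> hl; have hD := lmapD hl.
apply: (Defs.lpoly_ext (f := fun P => lsub s (lmap h P))
  (g := fun P => lmap h (lsub s P))) => [x y|x y|v a].
- by rewrite hD lsubD.
- by rewrite lsubD hD.
rewrite lmap_mono // [in LHS]lmonoE [in RHS]lmonoE !lsubZ !lsub_cst lmapZ //.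
by rewrite lmap_cst.
Qed.

Lemma in_vars_lmap V W (h : V -> W) k P : linear h ->
  in_vars k P -> in_vars k (lmap h P).
Proof.
by move=> hl /in_vars_lsub Pk; apply/in_vars_lsub; rewrite lsub_lmap // Pk.
Qed.

Lemma upd_comp U V (h : U -> V) (u : nat -> U) i x :
  h \o upd u i x = upd (h \o u) i (h x).
Proof. by apply/funext => j; rewrite /upd /=; case: ifP. Qed.

Lemma is_cochain_lmap U V U' V' n (h : U' -> U) (k : V -> V') (f : cochains U V) :
  linear h -> linear k -> is_cochain n f ->
  is_cochain n (fun u => lmap k (f (h \o u))).
Proof.
move=> hl kl fc; split=> [u v uv|u|u i c x y ilt|u i ilt|u].
- by congr lmap; apply: (coch_arity fc) => j jn /=; rewrite uv.
- exact/in_vars_lmap/(coch_vars fc).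
- by rewrite !upd_comp hl (coch_lin fc) // lmapD // lmapZ.
- by rewrite upd_comp (linear_scale hl) (coch_dd fc (h \o u)) // lmapZ.
- by rewrite upd_comp (linear_scale hl) (coch_ddlast fc (h \o u)) // lmapZ.
Qed.

Lemma sesquilinear_lmap U V W U' V' W' (op : U -> V -> lpoly W)
    (h : U' -> U) (h' : V' -> V) (k : W -> W') :
  linear h -> linear h' -> linear k -> sesquilinear op ->
  sesquilinear (fun u v => lmap k (op (h u) (h' v))).
Proof.
move=> hl h'l kl [ov oll olr odl odr]; split=> [u v|c u u' v|c u v v'|u v|u v].
- exact/in_vars_lmap.
- by rewrite hl oll lmapD // lmapZ.
- by rewrite h'l olr lmapD // lmapZ.
- by rewrite (linear_scale hl) odl lmapZ.
- by rewrite (linear_scale h'l) odr lmapZ.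
Qed.

Lemma sesquilinearD U V W (op op' : U -> V -> lpoly W) :
  sesquilinear op -> sesquilinear op' ->
  sesquilinear (fun u v => op u v + op' u v).
Proof.
move=> [ov oll olr odl odr] [ov' oll' olr' odl' odr'].
split=> [u v|c u u' v|c u v v'|u v|u v].
- exact: in_varsD.
- by rewrite oll oll' addrACA scalerDr.
- by rewrite olr olr' addrACA scalerDr.
- by rewrite odl odl' scalerDr.
- by rewrite odr odr' [RHS]scalerDr.
Qed.

Lemma is_cochain_sesquilinear U (W : lmodType {poly K}) (op : U -> U -> lpoly W) :
  sesquilinear op -> is_cochain 2 (fun u => op (u 0%N) (u 1%N)).
Proof.
move=> [ov oll olr odl odr]; split => //= [u v uv|u i c x y|u i|u].
- by rewrite !uv.
- by case: i => [|[|//]] _; rewrite /upd /=.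
- by case: i => [|//] _; rewrite /upd /= odl.
- by rewrite /upd /= odr big_ord1.
Qed.

Lemma sesquilinear_klinearl U V W (op : U -> V -> lpoly W) v :
  sesquilinear op -> klinear (op^~ v).
Proof. by move=> os c x y; apply: sesq_linl. Qed.

Lemma sesquilinear_klinearr U V W (op : U -> V -> lpoly W) u :
  sesquilinear op -> klinear (op u).
Proof. by move=> os c x y; apply: sesq_linr. Qed.

Lemma sesq0l U V W (op : U -> V -> lpoly W) (v : V) :
  sesquilinear op -> op 0 v = 0.
Proof. by move=> os; apply: morph_add0 (klinearD (sesquilinear_klinearl v os)). Qed.

Lemma sesq0r U V W (op : U -> V -> lpoly W) (u : U) :
  sesquilinear op -> op u 0 = 0.
Proof. by move=> os; apply: morph_add0 (klinearD (sesquilinear_klinearr u os)). Qed.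

Lemma lmap0 V W (h : V -> W) : lmap h 0 = 0.
Proof. exact: ext0. Qed.

Lemma conf_assocE U V W X Y Z (op1 : U -> V -> lpoly X) (op2 : X -> W -> lpoly Z)
    (op3 : V -> W -> lpoly Y) (op4 : U -> Y -> lpoly Z) :
  conf_assoc op1 op2 op3 op4 <-> forall u v w,
    ext (fun x => lsub (fun=> lam 0 + lam 1) (op2 x w))
        (lsub (fun=> lam 0) (op1 u v)) =
    ext (fun y => lsub (fun=> lam 0) (op4 u y)) (lsub (fun=> lam 1) (op3 v w)).
Proof. by rewrite unlock. Qed.

End Lmap.

(** * Cochains on the semidirect sum *)

Section SemidirectProduct.
Variables (K : fieldType) (A M : lmodType {poly K}).
Variables (mu : A -> A -> lpoly A) (l : A -> M -> lpoly M)
  (r : M -> A -> lpoly M).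
Hypotheses (hA : assoc_conformal_algebra mu) (hM : conformal_bimodule mu l r).
Let E : lmodType {poly K} := (A * M)%type.

Definition injA (a : A) : E := (a, 0).
Definition injM (m : M) : E := (0, m).

Lemma injA_linear : linear injA.
Proof.
by move=> c x y; apply: injective_projections; rewrite /= ?scaler0 ?addr0.
Qed.

Lemma injM_linear : linear injM.
Proof.
by move=> c x y; apply: injective_projections; rewrite /= ?scaler0 ?addr0.
Qed.

Lemma fst_linear : linear (fst : E -> A). Proof. by []. Qed.

Lemma snd_linear : linear (snd : E -> M). Proof. by []. Qed.

Hint Resolve injA_linear injM_linear fst_linear snd_linear : core.

(** The split extension of [A] by [M], in which the product of two elements of [M] is zero. *)
Definition semidirect (x y : E) : lpoly E :=
  lmap injA (mu x.1 y.1) + lmap injM (l x.1 y.2 + r x.2 y.1).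

Lemma theta_hatE : theta_hat mu l r = fun u => semidirect (u 0%N) (u 1%N).
Proof.
by apply/funext => u; rewrite /theta_hat; case: (u 0%N) => a m; case: (u 1%N).
Qed.

Let mus := aca_sesq hA.
Let ls := cbm_sesql hM.
Let rs := cbm_sesqr hM.

Lemma sesquilinear_semidirect : sesquilinear semidirect.
Proof.
apply: sesquilinearD; first exact: (sesquilinear_lmap (h := fst) (h' := fst)).
have -> : (fun x y : E => lmap injM (l x.1 y.2 + r x.2 y.1)) =
    fun x y => lmap injM (l x.1 y.2) + lmap injM (r x.2 y.1).
  by do 2!apply/funext => ?; rewrite lmapD.
apply: sesquilinearD.
  exact: (sesquilinear_lmap (h := fst) (h' := snd)).
exact: (sesquilinear_lmap (h := snd) (h' := fst)).
Qed.

Lemma is_cochain_theta : is_cochain 2 (theta_hat mu l r : cochains E E).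
Proof.
rewrite theta_hatE; exact: is_cochain_sesquilinear sesquilinear_semidirect.
Qed.

Lemma semidirectAl (a : A) (y : E) :
  semidirect (injA a) y = lmap injA (mu a y.1) + lmap injM (l a y.2).
Proof. by rewrite /semidirect /= (sesq0l _ rs) addr0. Qed.

Lemma semidirectMl (m : M) (y : E) : semidirect (injM m) y = lmap injM (r m y.1).
Proof.
by rewrite /semidirect /= (sesq0l _ mus) (sesq0l _ ls) lmap0 !add0r.
Qed.

Lemma semidirectAr (x : E) (a : A) :
  semidirect x (injA a) = lmap injA (mu x.1 a) + lmap injM (r x.2 a).
Proof. by rewrite /semidirect /= (sesq0r _ ls) add0r. Qed.

Lemma semidirectMr (x : E) (m : M) : semidirect x (injM m) = lmap injM (l x.1 m).
Proof.
by rewrite /semidirect /= (sesq0r _ mus) (sesq0r _ rs) lmap0 add0r addr0.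
Qed.

Lemma semidirect_assoc :
  conf_assoc semidirect semidirect semidirect semidirect.
Proof.
have sl s (y : E) : klinear (fun x => lsub (fun=> s) (semidirect x y)).
  exact/klinear_lsub/sesquilinear_klinearl/sesquilinear_semidirect.
have sr s (x : E) : klinear (fun y => lsub (fun=> s) (semidirect x y)).
  exact/klinear_lsub/sesquilinear_klinearr/sesquilinear_semidirect.
have extA s P (y : E) :
    ext (fun x => lsub (fun=> s) (semidirect x y)) (lmap injA P) =
    lmap injA (ext (fun a => lsub (fun=> s) (mu a y.1)) P) +
    lmap injM (ext (fun a => lsub (fun=> s) (l a y.2)) P).
  rewrite ext_lmap // (lmap_ext _ _ injA_linear) (lmap_ext _ _ injM_linear).
  rewrite -ext_funD; apply: eq_ext => a.
  by rewrite semidirectAl lsubD lsub_lmap // lsub_lmap.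
have extM s P (y : E) :
    ext (fun x => lsub (fun=> s) (semidirect x y)) (lmap injM P) =
    lmap injM (ext (fun m => lsub (fun=> s) (r m y.1)) P).
  rewrite ext_lmap // (lmap_ext _ _ injM_linear); apply: eq_ext => m.
  by rewrite semidirectMl lsub_lmap.
have extA' s P (x : E) :
    ext (fun y => lsub (fun=> s) (semidirect x y)) (lmap injA P) =
    lmap injA (ext (fun a => lsub (fun=> s) (mu x.1 a)) P) +
    lmap injM (ext (fun a => lsub (fun=> s) (r x.2 a)) P).
  rewrite ext_lmap // (lmap_ext _ _ injA_linear) (lmap_ext _ _ injM_linear).
  rewrite -ext_funD; apply: eq_ext => a.
  by rewrite semidirectAr lsubD lsub_lmap // lsub_lmap.
have extM' s P (x : E) :
    ext (fun y => lsub (fun=> s) (semidirect x y)) (lmap injM P) =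
    lmap injM (ext (fun m => lsub (fun=> s) (l x.1 m)) P).
  rewrite ext_lmap // (lmap_ext _ _ injM_linear); apply: eq_ext => m.
  by rewrite semidirectMr lsub_lmap.
apply/conf_assocE => u v w.
have sE s (x y : E) : lsub (fun=> s) (semidirect x y) =
    lmap injA (lsub (fun=> s) (mu x.1 y.1)) +
    (lmap injM (lsub (fun=> s) (l x.1 y.2)) +
     lmap injM (lsub (fun=> s) (r x.2 y.1))).
  rewrite /semidirect (lmapD injM_linear) 2!lsubD.
  by rewrite lsub_lmap // lsub_lmap // lsub_lmap.
rewrite (sE _ u v) (sE _ v w).
have := sr (lam 0) u; have := sl (lam 0 + lam 1) w.
move=> /klinearD slD /klinearD srD.
rewrite 2!(extD slD) 2!(extD srD) {slD srD}.
rewrite extA (extM _ _ w) (extM _ _ w) extA' (extM' _ _ u) (extM' _ _ u).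
have [/conf_assocE muA /conf_assocE lA] := (aca_assoc hA, cbm_assocl hM).
have [/conf_assocE rA /conf_assocE lrA] := (cbm_assocr hM, cbm_assoclr hM).
(* The component in [A] is the associativity of [mu]. The component in [M] has one term for each of
   the three arguments that may lie in [M], and each is a bimodule axiom; only the order of the
   summands differs. *)
rewrite muA lA rA lrA.
have addrACA' (V : zmodType) (x p q s : V) : x + p + (q + s) = x + s + (p + q).
  by zmod [:: x; p; q; s].
exact: addrACA'.
Qed.

(** The insertions into slots 0 and 1 carry opposite signs and are the two sides of
    associativity. *)
Lemma circ_theta_theta : circ 2 2 (theta_hat mu l r) (theta_hat mu l r) = 0.
Proof.
rewrite circE big_ord_recl big_ord1 /= theta_hatE; apply/funext => u.
have sv : forall x y, in_vars 1 (semidirect x y).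
  exact: sesq_vars sesquilinear_semidirect.
apply/eqP; rewrite subr_eq0; apply/eqP; rewrite icirc.unlock /insert /=.
transitivity (ext (fun x => lsub (fun=> lam 0 + lam 1) (semidirect x (u 2%N)))
    (lsub (fun=> lam 0) (semidirect (u 0%N) (u 1%N)))).
  (* The constant substitutions of [conf_assoc] and those of [icirc] agree on λ_0, the only variable
     of a sesquilinear product. *)
  congr ext; last by apply: (eq_lsub (k := 1)) => [|[|//] _]; [apply: sv|].
  apply/funext => x; apply: (eq_lsub (k := 1)) => [|[|//] _]; first exact: sv.
  by rewrite /merge_vars /= big_nat_recl // big_nat1.
have /conf_assocE -> := semidirect_assoc.
congr ext; last by apply: (eq_lsub (k := 1)) => [|[|//] _]; [apply: sv|].
apply/funext => x; apply: (eq_lsub (k := 1)) => [|[|//] _]; first exact: sv.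
by rewrite /merge_vars.
Qed.

Lemma lift_hatE f : lift_hat f = fun u : nat -> E => lmap injA (f (snd \o u)).
Proof. by []. Qed.

Lemma is_cochain_lift n (f : cochains M A) :
  is_cochain n f -> is_cochain n (lift_hat f).
Proof. by move=> fc; apply: (is_cochain_lmap (h := snd)). Qed.

(** A lift takes values in [A] and reads only the [M]-components of its arguments, so inserting one
    lift into another amounts to inserting 0. *)
Lemma circ_lift_lift m n (f g : cochains M A) :
  is_cochain m f -> circ m n (lift_hat f) (lift_hat g) = 0.
Proof.
move=> fc; rewrite circE big1 // => i _.
suff -> : icirc i n (lift_hat f) (lift_hat g) = 0 by rewrite /sgn oppr0 if_same.
apply/funext => u; rewrite icirc.unlock lift_hatE lsub_lmap //.
have lc := coch_multilin (is_cochain_lift fc).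
rewrite ext_lmap //; last exact/klinear_lsub/(klinear_insert _ _ lc).
rewrite -[RHS](ext_fun0 E (lsub (fun j => lam (i + j))
  (g (snd \o (fun j => u (i + j)%N))))).
apply: eq_ext => a; rewrite insert_upd upd_comp /=.
rewrite (morph_add0 (klinearD (coch_multilin fc (snd \o insert i n 0 u) _))) //.
by rewrite lmap0 lsub0.
Qed.

Lemma gerst_lift_lift m n (f g : cochains M A) :
  is_cochain m f -> is_cochain n g -> gerst m n (lift_hat f) (lift_hat g) = 0.
Proof.
by move=> fc gc; rewrite /gerst !circ_lift_lift // scaler0 subr0.
Qed.

(** * Weights *)

Definition dilation (c : K) (x : E) : E := (x.1, c%:P *: x.2).

Lemma dilation_linear c : linear (dilation c).
Proof.
move=> p x y; apply: injective_projections => //=.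
by rewrite scalerDr !scalerA mulrC.
Qed.

Hint Resolve dilation_linear : core.

Lemma dilation_injA c : dilation c \o injA = injA.
Proof. by apply/funext => a; rewrite /dilation /= scaler0. Qed.

Definition homogeneous (w : nat) (F : cochains E E) := forall c u,
  F (dilation c \o u) = scal (c ^+ w) *: lmap (dilation c) (F u).

Lemma homogeneousD w F G :
  homogeneous w F -> homogeneous w G -> homogeneous w (F + G).
Proof.
move=> hF hG c u; rewrite -![(F + G) _]/(F _ + G _) hF hG.
by rewrite [in RHS]lmapD // scalerDr.
Qed.

Lemma homogeneous_sgn w b F : homogeneous w F -> homogeneous w (sgn b F).
Proof.
move=> hF c u; case: b; last exact: hF.
by rewrite -![sgn true F _]/(- F _) hF (morph_addN (lmapD _)) // scalerN.
Qed.

Lemma homogeneous0 w : homogeneous w 0.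
Proof. by move=> c u; rewrite -![(0 : cochains E E) _]/0 lmap0 scaler0. Qed.

(** The [A]-component of the product involves no element of [M], and each term of its [M]-component
    is linear in exactly one. *)
Lemma homogeneous_theta : homogeneous 0 (theta_hat mu l r).
Proof.
move=> c u; rewrite theta_hatE expr0 Defs.scal1 scale1r /= /semidirect [RHS]lmapD //.
rewrite (lmap_lmap _ (dilation_linear c) injA_linear) dilation_injA.
rewrite (lmap_lmap _ (dilation_linear c) injM_linear); congr (_ + _) => /=.
have -> : dilation c \o injM = injM \o (fun m => c%:P *: m).
  by apply/funext => m.
have Zl : linear (fun m : M => c%:P *: m).
  by move=> p x y; rewrite scalerDr !scalerA mulrC.
rewrite -(lmap_lmap _ injM_linear Zl); congr lmap; rewrite lmapD //.
have Zext (P : lpoly M) : lmap (fun m => c%:P *: m) P = scal c *: P.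
  rewrite -[in RHS](lmap_id P) -ext_funZ; apply: eq_ext => m.
  by rewrite cstZ.
rewrite !Zext -(klinearZ c _ (sesquilinear_klinearr _ ls)).
by rewrite -(klinearZ c _ (sesquilinear_klinearl _ rs)).
Qed.

Lemma multilin_scale U V k (F : cochains U V) (s : nat -> K) u :
  is_cochain k F ->
  F (fun j => (s j)%:P *: u j) = scal (\prod_(j < k) s j) *: F u.
Proof.
move=> Fc.
have partial t : (t <= k)%N ->
    F (fun j => if (j < t)%N then (s j)%:P *: u j else u j) =
    scal (\prod_(j < t) s j) *: F u.
  elim: t => [_|t IH tk].
    by rewrite big_ord0 Defs.scal1 scale1r.
  rewrite big_ord_recr /= mulrC -Defs.scalM.
  have -> : (scal (s t) * scal (\prod_(j < t) s j)) *: F u =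
    scal (s t) *: (scal (\prod_(j < t) s j) *: F u) by rewrite [RHS]scalerA.
  rewrite -IH; last exact: ltnW.
  set v := fun j => if (j < t)%N then _ else _.
  rewrite -{1}[v](upd_id v t) -(klinearZ _ _ (coch_multilin Fc v tk)).
  congr F; apply/funext => j; rewrite /upd /v ltnS leq_eqVlt.
  by case: eqVneq => [->|] //=; rewrite ltnn.
rewrite -(partial k) //; apply: (coch_arity Fc) => j jk.
by rewrite jk.
Qed.

Lemma homogeneous_lift n (f : cochains M A) :
  is_cochain n f -> homogeneous n (lift_hat f).
Proof.
move=> fc c u; rewrite lift_hatE lmap_lmap // dilation_injA -lmapZ //.
congr lmap; have := multilin_scale (fun=> c) (snd \o u) fc.
by rewrite prodr_const card_ord => <-.
Qed.

(** The scalar of [G] leaves the extension, while the dilation of its value joins that of the other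
    arguments of [F], where the homogeneity of [F] applies. *)
Lemma homogeneous_icirc m i n w w' F G : multilin m F -> (i < m)%N ->
  homogeneous w F -> homogeneous w' G -> homogeneous (w + w') (icirc i n F G).
Proof.
move=> Fl im hF hG c u; rewrite icirc.unlock.
have Fk v : klinear (fun x => lsub (merge_vars K i n) (F (insert i n x v))).
  exact/klinear_lsub/klinear_insert/im.
rewrite [G _](hG c (fun j => u (i + j)%N)) lsubZ rsubst_scal lsub_lmap //.
rewrite (ext_scalar_scal _ _ (Fk _)).
rewrite ext_lmap // lmap_ext // exprD mulrC -Defs.scalM.
rewrite -[RHS]scalerA -[in RHS]ext_funZ; congr (_ *: _); apply: eq_ext => x.
have -> : insert i n (dilation c x) (dilation c \o u) = dilation c \o insert i n x u.
  by apply/funext => j; rewrite /insert /=; case: ifP => // _; case: ifP.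
by rewrite hF lsubZ rsubst_scal lsub_lmap.
Qed.

Lemma homogeneous_circ m n w w' F G : multilin m F ->
  homogeneous w F -> homogeneous w' G -> homogeneous (w + w') (circ m n F G).
Proof.
move=> Fl hF hG; rewrite circE; apply: big_ind => [||i _].
- exact: homogeneous0.
- exact: homogeneousD.
- exact/homogeneous_sgn/(homogeneous_icirc n Fl).
Qed.

Lemma homogeneous_gerst m n w w' F G : multilin m F -> multilin n G ->
  homogeneous w F -> homogeneous w' G -> homogeneous (w + w') (gerst m n F G).
Proof.
move=> Fl Gl hF hG; rewrite /gerst signE -sgnN; apply: homogeneousD.
  exact: homogeneous_circ.
rewrite sgnN -[- sgn _ _]/(sgn true _) addnC.
exact/homogeneous_sgn/homogeneous_sgn/homogeneous_circ.
Qed.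

Lemma lmap_fst_snd (P : lpoly E) :
  P = lmap injA (lmap fst P) + lmap injM (lmap snd P).
Proof.
rewrite (lmap_lmap _ injA_linear fst_linear) (lmap_lmap _ injM_linear snd_linear).
rewrite -{1}[P]lmap_id -ext_funD; apply: eq_ext => x.
rewrite -cst_is_additive; congr cst.
by apply: injective_projections; rewrite /= ?addr0 ?add0r.
Qed.

Lemma lmap_injAK (P : lpoly A) : lmap fst (lmap injA P) = P.
Proof. by rewrite lmap_lmap // -[RHS]lmap_id; apply: eq_ext. Qed.

(** * Cochains whose weight equals their arity are lifts *)

Hypothesis K_char0 : [pchar K] =i pred0.

(** In characteristic 0 the single dilation by 2 therefore separates all weights. *)
Lemma expr2_inj a b : (2%:R ^+ a : K) = 2%:R ^+ b -> a = b.
Proof.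
wlog ab : a b / (a <= b)%N.
  by move=> IH e; case/orP: (leq_total a b) => /IH; [apply | move=> /(_ (esym e))].
move/esym/eqP; rewrite -subr_eq0 -!natrX -natrB ?leq_exp2l //.
rewrite (pcharf0P K).1 // subn_eq0 leq_exp2l // => ba.
by apply/eqP; rewrite eqn_leq ab.
Qed.

Lemma scal_inj (V : lmodType {poly K}) c c' (P : lpoly V) :
  scal c *: P = scal c' *: P -> c <> c' -> P = 0.
Proof.
move=> e cc'; have d0 : c - c' != 0 by rewrite subr_eq0; apply/eqP.
have : scal (c - c') *: P = 0.
  rewrite Defs.scalD scalerDl e -scalerDl -Defs.scalD subrr.
  by rewrite (morph_add0 (@Defs.scalD K)) scale0r.
move/(congr1 ( *:%R (scal (c - c')^-1))); rewrite scaler0 [LHS]scalerA Defs.scalM.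
by rewrite mulVf // Defs.scal1 scale1r.
Qed.

Section PureArguments.
Variables (k : nat) (F : cochains E E).
Hypotheses (Fc : is_cochain k F) (Fh : homogeneous k F).

(** On pure arguments, each lying in [A] or in [M], this is the number of those in [M]; a zero
    argument counts as one of them. *)
Let weight (u : nat -> E) := (\sum_(j < k) ((u j).1 == 0%R))%N.

Let weight_le u : (weight u <= k)%N.
Proof.
rewrite -[X in (_ <= X)%N]card_ord -sum1_card; apply: leq_sum => j _.
exact: leq_b1.
Qed.

Let pure_scale c u : (forall j, (j < k)%N -> (u j).1 = 0 \/ (u j).2 = 0) ->
  F (dilation c \o u) = scal (c ^+ weight u) *: F u.
Proof.
move=> u_pure; rewrite expr_sum.
rewrite -(multilin_scale (fun j => c ^+ ((u j).1 == 0)) _ Fc).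
apply: (coch_arity Fc) => j jk; rewrite /dilation /=.
case: eqVneq => [u1|u1].
  by apply: injective_projections; rewrite //= u1 scaler0.
have [/eqP|u2] := u_pure j jk; first by rewrite (negPf u1).
by apply: injective_projections; rewrite /= ?u2 ?scaler0 // scale1r.
Qed.

(** Under dilation by 2, multilinearity scales the [M]-component by a power of exponent at most k,
    and homogeneity by the power k + 1. *)
Let pure_snd u : (forall j, (j < k)%N -> (u j).1 = 0 \/ (u j).2 = 0) ->
  lmap snd (F u) = 0.
Proof.
move=> u_pure; apply: (@scal_inj _ (2%:R ^+ weight u) (2%:R ^+ k.+1)).
  have := congr1 (lmap snd) (Fh 2%:R u); rewrite pure_scale //.
  rewrite 2!(lmapZ _ _ snd_linear) (lmap_lmap _ snd_linear (dilation_linear _)) => ->.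
  rewrite exprSr -Defs.scalM -[RHS]scalerA -[in RHS]ext_funZ; congr (_ *: _).
  by apply: eq_ext => x; rewrite /= cstZ.
by move/expr2_inj => wk; have := weight_le u; rewrite wk ltnn.
Qed.

Let pure_vanish u : (forall j, (j < k)%N -> (u j).1 = 0 \/ (u j).2 = 0) ->
  (weight u < k)%N -> F u = 0.
Proof.
move=> u_pure uk; rewrite [LHS]lmap_fst_snd pure_snd // lmap0 addr0.
rewrite (_ : lmap fst (F u) = 0) ?lmap0 //.
apply: (@scal_inj _ (2%:R ^+ weight u) (2%:R ^+ k)).
  have := congr1 (lmap fst) (Fh 2%:R u); rewrite pure_scale //.
  rewrite 2!(lmapZ _ _ fst_linear) (lmap_lmap _ fst_linear (dilation_linear _)) => ->.
  by congr (_ *: _); apply: eq_ext.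
by move/expr2_inj => wk; rewrite wk ltnn in uk.
Qed.

Let zero_arg u j : (j < k)%N -> u j = 0 -> F u = 0.
Proof.
move=> jk uj; rewrite -[u](upd_id _ j) uj.
exact: morph_add0 (klinearD (coch_multilin Fc u jk)).
Qed.

(** Only arguments of index below t may be mixed. Induction on t splits one of them into its two
    pure parts; by the induction hypothesis the [A]-part contributes a value of [F] with a zero
    argument. *)
Let F_proj t u : (forall j, (t <= j < k)%N -> (u j).1 = 0 \/ (u j).2 = 0) ->
  F u = F (fun j => (0, (u j).2)).
Proof.
elim: t u => [|t IH] u u_pure.
  have [ku|uk] := leqP k (weight u).
    apply: (coch_arity Fc) => j jk; apply: injective_projections => //=.
    apply/eqP; apply: contraLR ku => uj; rewrite -ltnNge.
    rewrite /weight (bigD1 (Ordinal jk)) //= (negPf uj) add0n.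
    rewrite -[X in (_ < X)%N]card_ord -sum1_card.
    rewrite [X in (_ < X)%N](bigD1 (Ordinal jk)) //=.
    by rewrite add1n ltnS; apply: leq_sum => i _; apply: leq_b1.
  rewrite pure_vanish //.
  (* With fewer than k arguments in [M], the left side vanishes. Some argument has a nonzero
     [A]-component, so by purity its [M]-component is 0, and the right side vanishes as well. *)
  have [j jk uj] : exists2 j, (j < k)%N & (u j).1 != 0.
    suff [j uj] : exists j : 'I_k, (u j).1 != 0 by exists j.
    apply/existsP; apply: contraLR uk; rewrite negb_exists -leqNgt => /forallP u0.
    rewrite -[X in (X <= _)%N]card_ord -sum1_card; apply: leq_sum => j _.
    by have := u0 j; rewrite negbK => /eqP ->; rewrite eqxx.
  apply/esym/(zero_arg jk); apply: injective_projections => //=.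
  by have [/eqP|//] := u_pure j jk; rewrite (negPf uj).
have [tk|kt] := ltnP t k; last first.
  apply: IH => j /andP[tj jk].
  by have := leq_ltn_trans (leq_trans kt tj) jk; rewrite ltnn.
have FD := klinearD (coch_multilin Fc u tk).
have uE : u t = injA (u t).1 + injM (u t).2.
  by apply: injective_projections; rewrite /= ?addr0 ?add0r.
rewrite -{1}[u](upd_id _ t) uE FD.
have pure_upd x : x.1 = 0 \/ x.2 = 0 ->
    forall j, (t <= j < k)%N -> (upd u t x j).1 = 0 \/ (upd u t x j).2 = 0.
  move=> x_pure j /andP[tj jk]; rewrite /upd; case: eqVneq => // jt.
  by apply: u_pure; rewrite jk andbT ltn_neqAle eq_sym jt.
rewrite (IH (upd u t (injA _))); last by apply: pure_upd; right.
rewrite (IH (upd u t (injM _))); last by apply: pure_upd; left.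
rewrite (zero_arg tk) ?updE // add0r; congr F; apply/funext => j.
by rewrite /upd; case: eqP => // ->.
Qed.

Lemma homogeneous_liftE : F = lift_hat (fun u => lmap fst (F (fun i => (0, u i)))).
Proof.
apply/funext => u; rewrite (F_proj (t := k)); last by move=> j; case: ltngtP.
rewrite lift_hatE [LHS]lmap_fst_snd pure_snd ?lmap0 ?addr0 // => j _.
by left.
Qed.

End PureArguments.

(** * The derived bracket *)

Local Notation theta := (theta_hat mu l r : cochains E E).
Local Notation br := (dbracket mu l r).

Let tc : is_cochain 2 theta := is_cochain_theta.
Let tl : multilin 2 theta := coch_multilin tc.

Lemma gerst_theta_theta : gerst 2 2 theta theta = 0.
Proof. by rewrite /gerst circ_theta_theta scaler0 subr0. Qed.

Lemma is_cochain_gerst_theta m f :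
  is_cochain m.+1 f -> is_cochain m.+2 (gerst 2 m.+1 theta f).
Proof. exact: is_cochain_gerst tc. Qed.

Lemma gerst0l m n (f : cochains E E) : multilin n f -> gerst m n 0 f = 0.
Proof. by move=> fl; apply: morph_add0 (linear_add (gerst_linear_l m fl)). Qed.

Lemma gerst0r m n (f : cochains E E) : multilin m f -> gerst m n f 0 = 0.
Proof. by move=> fl; apply: morph_add0 (linear_add (gerst_linear_r n fl)). Qed.

(** Since [θ, θ] = 0, the Jacobi identity for θ, θ, [f] says that this element equals its opposite,
    and 2 is invertible. *)
Lemma gerst_theta_gerst_theta m f : is_cochain m.+1 f ->
  gerst 2 m.+2 theta (gerst 2 m.+1 theta f) = 0.
Proof.
move=> fc; have := jacobi_gerst tc tc fc.
rewrite gerst_theta_theta gerst0l ?add0r; last exact: coch_multilin.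
set x := gerst _ _ _ _ => /eqP; rewrite /= -subr_eq0 opprK => /eqP xx.
have : (2%:R : K) *: x = 0 by rewrite -[2%:R]/(1 + 1) scalerDl scale1r.
move/(congr1 ( *:%R 2%:R^-1)); rewrite scalerA mulVf ?scale1r ?scaler0 //.
by rewrite (pcharf0P K).1.
Qed.

Lemma derivedE m n f g : derived mu l r m.+1 n f g =
  sgn (~~ odd m) (gerst m.+2 n (gerst 2 m.+1 theta f) g).
Proof. by rewrite /derived signE. Qed.

Lemma is_cochain_derived m n f g : is_cochain m.+1 f -> is_cochain n.+1 g ->
  is_cochain (m.+1 + n.+1) (derived mu l r m.+1 n.+1 f g).
Proof.
move=> fc gc; rewrite derivedE addnS; apply: is_cochain_sgn.
exact/is_cochain_gerst/gc/is_cochain_gerst_theta.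
Qed.

Lemma derived_linear_l m n g : multilin n g ->
  linear (fun f => derived mu l r m n f g).
Proof.
move=> gl c f f'; rewrite /derived (gerst_linear_r m tl) (gerst_linear_l _ gl).
by rewrite scalerDr !scalerA mulrC.
Qed.

Lemma derived_linear_r m n f : multilin m.+1 (gerst 2 m theta f) ->
  linear (derived mu l r m n f).
Proof.
move=> fl c g g'; rewrite /derived (gerst_linear_r n fl).
by rewrite scalerDr !scalerA mulrC.
Qed.

Lemma lift_hat_linear : linear (@lift_hat K A M).
Proof.
move=> c f g; apply/funext => u; rewrite lift_hatE.
rewrite -[(c *: f + g) _]/(scal c *: f _ + g _).
by rewrite (lmapD injA_linear) (lmapZ _ _ injA_linear).
Qed.

Lemma lift_hatK (f : cochains M A) :
  (fun u => lmap fst (lift_hat f (fun i => (0, u i)))) = f.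
Proof. by apply/funext => u; rewrite lift_hatE lmap_injAK. Qed.

Lemma lift_hat_inj : injective (@lift_hat K A M).
Proof. by move=> f g fg; rewrite -[f]lift_hatK fg lift_hatK. Qed.

Lemma lift_hat_sgn b f : lift_hat (sgn b f) = sgn b (lift_hat f : cochains E E).
Proof. exact: morph_sgn (linear_add lift_hat_linear) _. Qed.

(** θ has weight 0 and the lifts have weights m + 1 and n + 1, so the derived bracket has weight
    equal to its arity and [homogeneous_liftE] applies. *)
Lemma lift_dbracket m n (f g : cochains M A) :
  is_cochain m.+1 f -> is_cochain n.+1 g ->
  lift_hat (br m.+1 n.+1 f g) =
  derived mu l r m.+1 n.+1 (lift_hat f) (lift_hat g).
Proof.
move=> fc gc; have [fc' gc'] := (is_cochain_lift fc, is_cochain_lift gc).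
apply/esym/(@homogeneous_liftE (m.+1 + n.+1)); first exact: is_cochain_derived.
rewrite derivedE; apply: homogeneous_sgn.
rewrite -[m.+1]add0n; have Dc := is_cochain_gerst_theta fc'.
apply: homogeneous_gerst; [exact: coch_multilin|exact: coch_multilin| |].
  apply: homogeneous_gerst => //; first exact: coch_multilin.
    exact: homogeneous_theta.
  exact: homogeneous_lift.
exact: homogeneous_lift.
Qed.

Lemma is_cochain_dbracket m n (f g : cochains M A) :
  is_cochain m.+1 f -> is_cochain n.+1 g ->
  is_cochain (m.+1 + n.+1) (br m.+1 n.+1 f g).
Proof.
move=> /is_cochain_lift fc /is_cochain_lift gc.
exact: (is_cochain_lmap injM_linear fst_linear (is_cochain_derived fc gc)).
Qed.

(** Applying [θ, -] to [f, g] = 0 relates [[θ, f], g] to [f, [θ, g]], which the antisymmetry of the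
    Gerstenhaber bracket turns around. *)
Lemma derived_antisym m n (f g : cochains E E) :
  is_cochain m.+1 f -> is_cochain n.+1 g -> gerst m.+1 n.+1 f g = 0 ->
  derived mu l r m.+1 n.+1 f g =
  - sgn (odd (m.+1 * n.+1)) (derived mu l r n.+1 m.+1 g f).
Proof.
move=> fc gc fg; rewrite !derivedE.
have gDf : gerst m.+1 n.+2 f (gerst 2 n.+1 theta g) =
    - sgn (odd (m * n.+1)) (gerst n.+2 m.+1 (gerst 2 n.+1 theta g) f).
  rewrite !gerstE sgnD sgnN sgn_sgn (mulnC m) addbb /= opprD opprK addrC.
  by [].
have := jacobi_gerst tc fc gc; rewrite fg gerst0r // mul1n gDf.
move/esym/eqP; rewrite addr_eq0 => /eqP ->.
rewrite !sgnN opprK -[- sgn _ (sgn _ _)]/(sgn true _) !sgn_sgn.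
congr sgn; rewrite !oddM /=; by case: (odd m); case: (odd n).
Qed.

(** The Jacobi identity of the Gerstenhaber bracket for D f, D g and [h], where D = [θ, -]. *)
Lemma derived_jacobi m n p (f g h : cochains E E) :
  is_cochain m.+1 f -> is_cochain n.+1 g -> is_cochain p.+1 h ->
  derived mu l r m.+1 (n.+1 + p.+1) f (derived mu l r n.+1 p.+1 g h) =
  derived mu l r (m.+1 + n.+1) p.+1 (derived mu l r m.+1 n.+1 f g) h +
  sgn (odd (m.+1 * n.+1))
    (derived mu l r n.+1 (m.+1 + p.+1) g (derived mu l r m.+1 p.+1 f h)).
Proof.
move=> fc gc hc; rewrite !addSn !derivedE.
have [Df Dg] := (is_cochain_gerst_theta fc, is_cochain_gerst_theta gc).
(* D is a derivation with D (D f) = 0, so D [D f, g] is [D f, D g] up to sign. *)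
have DDf : gerst 2 (m + n.+1).+1 theta (gerst m.+2 n.+1 (gerst 2 m.+1 theta f) g) =
    sgn (~~ odd m) (gerst m.+2 n.+2 (gerst 2 m.+1 theta f) (gerst 2 n.+1 theta g)).
  rewrite addnS -addSn; have := jacobi_gerst tc Df gc; rewrite mul1n /= => ->.
  by rewrite gerst_theta_gerst_theta // gerst0l ?add0r //; apply: coch_multilin.
have lr q k (x : cochains E E) : is_cochain q x ->
    {morph (gerst q k x : cochains E E -> cochains E E) : y z / y + z}.
  by move=> xc; apply: linear_add (gerst_linear_r k (coch_multilin xc)).
have ll q k (x : cochains E E) : is_cochain q x ->
    {morph (fun y : cochains E E => gerst k q y x) : y z / y + z}.
  by move=> xc; apply: linear_add (gerst_linear_l k (coch_multilin xc)).
rewrite (morph_sgn _ (lr _ _ _ Df)) (morph_sgn _ (lr _ _ _ Dg)).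
rewrite (morph_sgn _ (lr _ _ _ tc)) DDf !(morph_sgn _ (ll _ _ _ hc)).
have := jacobi_gerst Df Dg hc; rewrite !addSn !addnS => ->.
rewrite sgn_sgn sgnD !sgn_sgn; congr (sgn _ _ + sgn _ _).
  by rewrite /= oddD; case: (odd m); case: (odd n).
by case: (odd (_ * _)); case: (odd m); case: (odd n).
Qed.

(** * The axioms of a graded Lie algebra *)

Lemma cochain_pieceP n (f : cochains M A) : cochain_piece n f ->
  is_cochain n f /\ (n = 0%N -> f = 0).
Proof. by case: n => [->|n fc]; split=> //; apply: is_cochain0. Qed.

Lemma cochain_piece0 n : cochain_piece n (0 : cochains M A).
Proof. by case: n => //= n; apply: is_cochain0. Qed.

Lemma dbracket_linear_l m n g : is_cochain n g -> linear (fun f => br m n f g).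
Proof.
move=> /is_cochain_lift/coch_multilin gl c f f'; apply/funext => u.
rewrite /dbracket lift_hat_linear (derived_linear_l m gl).
rewrite -[RHS]/(scal c *: lmap fst (derived _ _ _ _ _ _ _ _) +
  lmap fst (derived _ _ _ _ _ _ _ _)).
by rewrite -(lmapZ _ _ fst_linear) -(lmapD fst_linear).
Qed.

Lemma multilin_gerst_theta m f : cochain_piece m f ->
  multilin m.+1 (gerst 2 m theta (lift_hat f)).
Proof.
case: m => [->|m /is_cochain_lift fc]; last first.
  exact/coch_multilin/is_cochain_gerst_theta.
rewrite (morph_add0 (linear_add lift_hat_linear)) gerst0r //.
exact/coch_multilin/is_cochain0.
Qed.

Lemma dbracket_linear_r m n f : cochain_piece m f -> linear (br m n f).
Proof.
move=> /multilin_gerst_theta fl c g g'; apply/funext => u.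
rewrite /dbracket lift_hat_linear (derived_linear_r n fl).
rewrite -[RHS]/(scal c *: lmap fst (derived _ _ _ _ _ _ _ _) +
  lmap fst (derived _ _ _ _ _ _ _ _)).
by rewrite -(lmapZ _ _ fst_linear) -(lmapD fst_linear).
Qed.

Lemma dbracket0l m n g : is_cochain n g -> br m n 0 g = 0.
Proof. by move=> gc; apply: morph_add0 (linear_add (dbracket_linear_l m gc)). Qed.

Lemma dbracket0r m n f : cochain_piece m f -> br m n f 0 = 0.
Proof. by move=> fc; apply: morph_add0 (linear_add (dbracket_linear_r n fc)). Qed.

Lemma cochain_piece_dbracket m n f g : cochain_piece m f -> cochain_piece n g ->
  cochain_piece (m + n) (br m n f g).
Proof.
move=> fp gp; have [[fc f0] [gc g0]] := (cochain_pieceP fp, cochain_pieceP gp).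
case: m => [|m] in fp fc f0 *.
  by rewrite (f0 erefl) (dbracket0l 0 gc); apply: cochain_piece0.
case: n => [|n] in gp gc g0 *.
  by rewrite (g0 erefl) (dbracket0r 0 fp); apply: cochain_piece0.
exact: is_cochain_dbracket.
Qed.

Lemma graded_lie_dbracket : graded_lie (@cochain_piece _ M A) br.
Proof.
split=> [n|n c f g|m n f g|m n c f f' g _ _ gp|m n c f g g' fp _ _|m n f g
  |m n p f g h].
- exact: cochain_piece0.
- case: n => [-> ->|n]; first by rewrite /= scaler0 addr0.
  exact: is_cochain_lin.
- exact: cochain_piece_dbracket.
- exact/dbracket_linear_l/(cochain_pieceP gp).1.
- exact: dbracket_linear_r.
- move=> fp gp; rewrite signE.
  have [[fc f0] [gc g0]] := (cochain_pieceP fp, cochain_pieceP gp).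
  (* The component of degree 0 is zero, so every term vanishes there. *)
  case: m => [|m] in fp fc f0 *.
    by rewrite (f0 erefl) (dbracket0l 0 gc) (dbracket0r 0 gp) sgn0 oppr0.
  case: n => [|n] in gp gc g0 *.
    by rewrite (g0 erefl) (dbracket0r 0 fp) (dbracket0l 0 fc) sgn0 oppr0.
  apply: lift_hat_inj.
  rewrite -[- sgn _ _]/(sgn true _) 2!lift_hat_sgn.
  rewrite (lift_dbracket fc gc) (lift_dbracket gc fc).
  apply: derived_antisym; [exact: is_cochain_lift|exact: is_cochain_lift|].
  exact: gerst_lift_lift.
move=> fp gp hp; rewrite signE.
have [[fc f0] [gc g0]] := (cochain_pieceP fp, cochain_pieceP gp).
have [hc h0] := cochain_pieceP hp.
have [gh_c _] := cochain_pieceP (cochain_piece_dbracket gp hp).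
have [fh_c _] := cochain_pieceP (cochain_piece_dbracket fp hp).
have [fg_c _] := cochain_pieceP (cochain_piece_dbracket fp gp).
case: m => [|m] in fp fc f0 fh_c fg_c *.
  rewrite (f0 erefl) (dbracket0l 0 gh_c) (dbracket0l 0 gc) (dbracket0l 0 hc).
  by rewrite (dbracket0l _ hc) (dbracket0r _ gp) sgn0 addr0.
case: n => [|n] in gp gc g0 gh_c fg_c *.
  rewrite (g0 erefl) (dbracket0l 0 hc) (dbracket0r (0 + p) fp) (dbracket0r 0 fp).
  by rewrite (dbracket0l _ hc) (dbracket0l 0 fh_c) sgn0 addr0.
case: p => [|p] in hp hc h0 gh_c fh_c *.
  rewrite (h0 erefl) (dbracket0r 0 gp) (dbracket0r 0 fp) (dbracket0r _ fp).
  rewrite (dbracket0r 0 (cochain_piece_dbracket fp gp)) (dbracket0r _ gp).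
  by rewrite sgn0 addr0.
(* The lift is injective and carries [dbracket] to [derived] in positive degrees, so the identity is
   inherited from cochains on [E]. *)
apply: lift_hat_inj.
rewrite (linear_add lift_hat_linear) lift_hat_sgn.
have fghE := etrans (lift_dbracket fc gh_c)
  (congr1 (derived mu l r m.+1 (n.+1 + p.+1) (lift_hat f)) (lift_dbracket gc hc)).
have gfhE := etrans (lift_dbracket gc fh_c)
  (congr1 (derived mu l r n.+1 (m.+1 + p.+1) (lift_hat g)) (lift_dbracket fc hc)).
have fg_hE := etrans (lift_dbracket fg_c hc)
  (congr1 (fun x => derived mu l r (m.+1 + n.+1) p.+1 x (lift_hat h))
    (lift_dbracket fc gc)).
apply: (etrans fghE); apply/esym.
apply: (etrans (congr2 (fun x y : cochains E E => x + sgn _ y) fg_hE gfhE)).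
exact/esym/(derived_jacobi (is_cochain_lift fc) (is_cochain_lift gc)
  (is_cochain_lift hc)).
Qed.

(** * O-operators *)

Lemma merge_vars1 i : merge_vars K i 1 = lam.
Proof.
apply/funext => k; rewrite /merge_vars !addn1 /=.
by case: ltngtP => // ->; rewrite big_nat1.
Qed.

Lemma icirc_hom1r m i (F : cochains E E) (t : E -> E) u : multilin m F ->
  (i < m)%N ->
  icirc i 1 F (fun v => cst (t (v 0%N))) u = F (upd u i (t (u i))).
Proof.
move=> Fl im; rewrite icirc.unlock lsub_cst addn0 ext_cst; last first.
  exact/klinearD/klinear_lsub/(klinear_insert 1 u Fl im).
rewrite merge_vars1 lsub_lam insert_upd; congr F; apply/funext => j.
rewrite /upd /insert; case: ltngtP => // _.
by rewrite addn1.
Qed.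

Lemma icirc_hom1l n (t : E -> E) (G : cochains E E) u : linear t ->
  icirc 0 n (fun v => cst (t (v 0%N))) G u = lmap t (G u).
Proof.
move=> t_lin; rewrite icirc.unlock; congr ext; last exact: lsub_lam.
by apply/funext => x; rewrite lsub_cst.
Qed.

(** For a product [F], this bracket measures how far [t] is from being a derivation. *)
Lemma gerst_hom1 (F : cochains E E) (t : E -> E) u :
  linear t -> is_cochain 2 F ->
  gerst 2 1 F (fun v => cst (t (v 0%N))) u =
  F (upd u 0 (t (u 0%N))) + F (upd u 1 (t (u 1%N))) - lmap t (F u).
Proof.
move=> tlin /coch_multilin Fl; rewrite gerstE !circE big_ord1 big_ord_recl big_ord1.
set t1 := fun v : nat -> E => _.
transitivity (icirc 0 1 F t1 u + icirc 1 1 F t1 u - icirc 0 2 t1 F u); first by [].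
by rewrite !(icirc_hom1r _ _ Fl) // icirc_hom1l.
Qed.

Section OOperator.
Variable T : {linear M -> A}.

(** The endomorphism of [E] whose associated unary cochain is the lift of [T]; its square is
    zero. *)
Definition lift_map (x : E) : E := injA (T x.2).

Lemma lift_map_linear : linear lift_map.
Proof. by move=> c x y; rewrite /lift_map linearP injA_linear. Qed.

Lemma lift_hom1 : lift_hat (hom1 T) = fun u : nat -> E => cst (lift_map (u 0%N)).
Proof. by apply/funext => u; rewrite lift_hatE lmap_cst. Qed.

Definition O_defect (m n : M) : lpoly A :=
  mu (T m) (T n) - lmap T (l (T m) n + r m (T n)).

Lemma fst_semidirect_lift_map x y :
  lmap fst (semidirect (lift_map x) (lift_map y)) = mu (T x.2) (T y.2).
Proof.
by rewrite semidirectAl /= (sesq0r _ ls) lmap0 addr0 lmap_injAK.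
Qed.

Lemma fst_lift_mapl m n :
  lmap fst (lmap lift_map (semidirect (lift_map (injM m)) (injM n))) =
  lmap T (l (T m) n).
Proof.
rewrite semidirectMr /= (lmap_lmap _ fst_linear lift_map_linear).
have fl : linear (fst \o lift_map) by move=> c x y; rewrite /= linearP.
by rewrite (lmap_lmap _ fl injM_linear).
Qed.

Lemma fst_lift_mapr m n :
  lmap fst (lmap lift_map (semidirect (injM m) (lift_map (injM n)))) =
  lmap T (r m (T n)).
Proof.
rewrite semidirectMl /= (lmap_lmap _ fst_linear lift_map_linear).
have fl : linear (fst \o lift_map) by move=> c x y; rewrite /= linearP.
by rewrite (lmap_lmap _ fl injM_linear).
Qed.

Lemma lift_map_lift_map x : lift_map (lift_map x) = 0.
Proof. by rewrite /lift_map /= linear0. Qed.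

Lemma lmap_lift_map_lift_map (P : lpoly E) : lmap lift_map (lmap lift_map P) = 0.
Proof.
rewrite (lmap_lmap _ lift_map_linear lift_map_linear) -[RHS](lmap_fun0 E P).
by apply: eq_ext => x; rewrite /= lift_map_lift_map.
Qed.

Lemma dbracket_hom1 u :
  br 1 1 (hom1 T) (hom1 T) u = - (O_defect (u 0%N) (u 1%N) *+ 2).
Proof.
rewrite /dbracket derivedE /= lift_hom1.
have fD := lmapD fst_linear; have fN := morph_addN fD.
have tD := lmapD lift_map_linear; have tN := morph_addN tD.
have Bc : is_cochain 2 (gerst 2 1 theta (fun v => cst (lift_map (v 0%N)))).
  apply: is_cochain_gerst_theta; rewrite -lift_hom1; apply: is_cochain_lift.
  by apply/cochain1P; exists T.
pose v i : E := injM (u i).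
set t1 := fun w : nat -> E => _ in Bc *.
transitivity (lmap fst (- gerst 2 1 (gerst 2 1 theta t1) t1 v)); first by [].
(* With t = [lift_map], the summands S(t t x, y), S(x, t t y) and t t S(x, y) vanish, and each of
   S(t x, t y), t S(t x, y), t S(x, t y) occurs twice; this is the factor 2. *)
have expand (S : E -> E -> lpoly E) (x y : E) :
    (forall z, S 0 z = 0) -> (forall z, S z 0 = 0) ->
    lmap fst (S (lift_map (lift_map x)) y + S (lift_map x) (lift_map y) -
        lmap lift_map (S (lift_map x) y) +
      (S (lift_map x) (lift_map y) + S x (lift_map (lift_map y)) -
        lmap lift_map (S x (lift_map y))) -
      lmap lift_map (S (lift_map x) y + S x (lift_map y) - lmap lift_map (S x y))) =
    (lmap fst (S (lift_map x) (lift_map y)) -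
      (lmap fst (lmap lift_map (S (lift_map x) y)) +
       lmap fst (lmap lift_map (S x (lift_map y))))) *+ 2.
  move=> S0l S0r; rewrite !lift_map_lift_map S0l S0r add0r addr0.
  rewrite !(tD, tN) lmap_lift_map_lift_map subr0 !(fD, fN) mulr2n.
  set a := lmap fst _; set b := lmap fst _; set c := lmap fst _.
  by zmod [:: a; b; c].
have BE w : gerst 2 1 theta t1 w = semidirect (lift_map (w 0%N)) (w 1%N) +
    semidirect (w 0%N) (lift_map (w 1%N)) -
    lmap lift_map (semidirect (w 0%N) (w 1%N)).
  by rewrite (gerst_hom1 _ lift_map_linear tc) theta_hatE.
rewrite fN (gerst_hom1 _ lift_map_linear Bc) 3!BE /O_defect (lmapD (linearP T)).
rewrite -fst_lift_mapl -fst_lift_mapr.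
rewrite -[mu _ _](fst_semidirect_lift_map (injM (u 0%N)) (injM (u 1%N))).
congr (- _); apply: expand => z.
- exact: sesq0l sesquilinear_semidirect.
- exact: sesq0r sesquilinear_semidirect.
Qed.

Lemma O_operatorP : O_operator mu l r T <-> br 1 1 (hom1 T) (hom1 T) = 0.
Proof.
split=> [OT|br0 m n].
  apply/funext => u; rewrite dbracket_hom1 /O_defect OT subrr mul0rn.
  exact: oppr0.
(* The bracket is evaluated on the sequence m, n, n, ..., of which only the first two entries enter
   the defect. *)
have := congr1 (fun f : cochains M A => f (fun i => if i is 0%N then m else n)) br0.
rewrite dbracket_hom1 /= => /eqP; rewrite oppr_eq0 mulr2n => /eqP dd0.
apply/eqP; rewrite -subr_eq0; apply/eqP; apply: (@scal_inj _ 2%:R 0).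
  rewrite (morph_add0 (@Defs.scalD K)) scale0r -[2%:R]/(1 + 1) Defs.scalD.
  by rewrite scalerDl Defs.scal1 scale1r.
by apply/eqP; rewrite (pcharf0P K).1.
Qed.

End OOperator.

(** * The differential and the Maurer-Cartan equation *)

Lemma dg_lie_dbracket (T : {linear M -> A}) : O_operator mu l r T ->
  dg_lie (@cochain_piece _ M A) br (fun n => br 1 n (hom1 T)).
Proof.
have Tp : cochain_piece 1 (hom1 T) by apply/cochain1P; exists T.
move=> /O_operatorP TT; have [_ _ deg _ linr _ jac] := graded_lie_dbracket.
split=> [|n a|n c a b ap bp|n a ap|m n a b ap bp].
- exact: graded_lie_dbracket.
- exact: deg Tp.
- exact: linr.
(* As [[T, T]] = 0 and T has odd degree, the Jacobi identity for T, T, a makes d (d a) equal to its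
   opposite. *)
- have := jac _ _ _ _ _ _ Tp Tp ap.
  rewrite TT (dbracket0l _ (cochain_pieceP ap).1) add0r expr1 scaleN1r.
  move/eqP; rewrite -subr_eq0 opprK => /eqP xx.
  have /(congr1 ( *:%R 2%:R^-1)) :
      (2%:R : K) *: br 1 n.+1 (hom1 T) (br 1 n (hom1 T) a) = 0.
    by rewrite -[2%:R]/(1 + 1) scalerDl scale1r.
  rewrite scalerA mulVf ?scale1r ?scaler0 //.
  by rewrite (pcharf0P K).1.
(* The Leibniz rule is the Jacobi identity with first entry T, of degree 1. *)
- by have := jac _ _ _ _ _ _ Tp ap bp; rewrite mul1n.
Qed.

(** The bracket is symmetric in degree 1, so [[T + T', T + T']] = 2 [[T, T']] + [[T', T']] once
    [[T, T]] = 0: twice the Maurer-Cartan expression. *)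
Lemma O_operator_add (T T' S : {linear M -> A}) :
  (forall x, S x = T x + T' x) -> O_operator mu l r T ->
  O_operator mu l r S <->
  br 1 1 (hom1 T) (hom1 T') + 2%:R^-1 *: br 1 1 (hom1 T') (hom1 T') = 0.
Proof.
move=> SE /O_operatorP TT.
have piece (U : {linear M -> A}) : cochain_piece 1 (hom1 U).
  by apply/cochain1P; exists U.
have [_ _ _ _ _ asym _] := graded_lie_dbracket.
have two0 : (2%:R : K) != 0 by rewrite (pcharf0P K).1.
suff SS : br 1 1 (hom1 S) (hom1 S) = (2%:R : K) *:
    (br 1 1 (hom1 T) (hom1 T') + 2%:R^-1 *: br 1 1 (hom1 T') (hom1 T')).
  split=> [/O_operatorP|e]; last by apply/O_operatorP; rewrite SS e scaler0.
  rewrite SS => /(congr1 ( *:%R 2%:R^-1)).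
  by rewrite scaler0 scalerA mulVf // scale1r.
have -> : hom1 S = hom1 T + hom1 T'.
  by apply/funext => u; rewrite /hom1 SE cst_is_additive.
have lD U := linear_add (dbracket_linear_l 1 (piece U)).
have rD U := linear_add (dbracket_linear_r 1 (piece U)).
have -> : br 1 1 (hom1 T + hom1 T') (hom1 T + hom1 T') =
    br 1 1 (hom1 T) (hom1 T + hom1 T') + br 1 1 (hom1 T') (hom1 T + hom1 T').
  apply: (linear_add (dbracket_linear_l 1 _)).
  by apply: is_cochainD; apply: piece.
rewrite (rD T) (rD T') TT add0r.
rewrite (asym 1%N 1%N (hom1 T') (hom1 T)) // expr1 scaleN1r opprK.
rewrite scalerDr scalerA divff // scale1r addrA; congr (_ + _).
by rewrite -[2%:R]/(1 + 1) scalerDl scale1r.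
Qed.

End SemidirectProduct.

(** The results on the derived bracket hold over a field of characteristic 0; here it is [R[i]], the
    complex numbers over a model [R] of the reals. *)
Theorem theorem6p7 (R : realType) (A M : lmodType {poly R[i]})
    (mu : A -> A -> lpoly A) (l : A -> M -> lpoly M) (r : M -> A -> lpoly M)
    (hA : assoc_conformal_algebra mu) (hM : conformal_bimodule mu l r) :
  ((forall (m n : nat) (f g : cochains M A), (0 < m)%N -> (0 < n)%N ->
      is_cochain m f -> is_cochain n g ->
      lift_hat (dbracket mu l r m n f g) =
        derived mu l r m n (lift_hat f) (lift_hat g)) /\
   graded_lie (@cochain_piece _ M A) (dbracket mu l r) /\
   (forall T : {linear M -> A},
      O_operator mu l r T <-> dbracket mu l r 1 1 (hom1 T) (hom1 T) = 0)) /\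
  (forall T : {linear M -> A}, O_operator mu l r T ->
     dg_lie (@cochain_piece _ M A) (dbracket mu l r)
       (fun n => dbracket mu l r 1 n (hom1 T)) /\
     (forall T' : {linear M -> A},
        O_operator mu l r (T \+ T') <->
        dbracket mu l r 1 1 (hom1 T) (hom1 T') +
          2%:R^-1 *: dbracket mu l r 1 1 (hom1 T') (hom1 T') = 0)).
Proof.
have C0 : [pchar R[i]] =i pred0 := Num.Theory.pchar_num _.
split; first split.
- by move=> [//|m] [//|n] f g _ _; apply: lift_dbracket.
- by split; [apply: graded_lie_dbracket | move=> T; apply: O_operatorP].
move=> T OT; split; first exact: dg_lie_dbracket.
by move=> T'; apply: O_operator_add.
Qed.
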